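(* Assume that the constrained integrator (A) or (B) defined in the context is locally well-defined, and set $\nu=\bar\nu\,\delta t$ with $\bar\nu>0$ fixed. Then the numerical scheme (A) or (B) (computed with or without the Fixman correcting forces $\nabla_qV_{\mathrm{fix},\nu}$) is of order $2$ and consistent with respect to the original exact deterministic dynamics $$\dot q=M^{-1}p,\qquad\dot p=-\nabla_qV(q),$$ i.e. on bounded time intervals the numerical trajectories $(q_n,p_n)$ converge uniformly to the exact trajectory $(q(n\,\delta t),p(n\,\delta t))$ with the same initial condition, at rate $O(\delta t^2)$ as $\delta t\to0$.
   Context: $M$ ($d\times d$), $M_z$ ($n\times n$) are symmetric positive definite, $\beta>0$, $V:\mathbb{R}^d\to\mathbb{R}$, $\xi:\mathbb{R}^d\to\mathbb{R}^n$ smooth (with the usual global Lipschitz conditions ensuring well-posedness); $(\nabla_q\xi)_{ji}=\partial\xi_i/\partial q_j$. $M_\nu(q)=M+\nu^2\nabla_q\xi M_z\nabla_q^T\xi$ and $V_{\mathrm{fix},\nu}=\frac1{2\beta}\ln\det M_\nu$. Integrator (A): with Lagrange multipliers $\lambda_{n+1/2},\lambda_{n+1}\in\mathbb{R}^n$, $p_{n+1/2}=p_n-\frac{\delta t}2(\nabla_qV+\nabla_qV_{\mathrm{fix},\nu})(q_n)-\nabla_q\xi(q_n)\lambda_{n+1/2}$, $p^z_{n+1/2}=p^z_n+\frac1\nu\lambda_{n+1/2}$; $q_{n+1}=q_n+\delta t\,M^{-1}p_{n+1/2}$, $z_{n+1}=z_n+\delta t\,M_z^{-1}p^z_{n+1/2}$,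 with $\xi(q_{n+1})=z_{n+1}/\nu$; $p_{n+1}=p_{n+1/2}-\frac{\delta t}2(\nabla_qV+\nabla_qV_{\mathrm{fix},\nu})(q_{n+1})-\nabla_q\xi(q_{n+1})\lambda_{n+1}$, $p^z_{n+1}=p^z_{n+1/2}+\frac1\nu\lambda_{n+1}$, with $\nabla_q^T\xi(q_{n+1})M^{-1}p_{n+1}=\frac1\nu M_z^{-1}p^z_{n+1}$. Integrator (B), used when $V(q)=U(q,\xi(q))$ for a known smooth $U$: same as (A) except that in the $p$-updates $\nabla_qV(q)$ is replaced by $\nabla_1U(q,\xi(q))$ and the $p^z$-updates become $p^z_{n+1/2}=p^z_n-\frac{\delta t}{2\nu}\nabla_2U(q_n,\xi(q_n))+\frac1\nu\lambda_{n+1/2}$ and $p^z_{n+1}=p^z_{n+1/2}-\frac{\delta t}{2\nu}\nabla_2U(q_{n+1},\xi(q_{n+1}))+\frac1\nu\lambda_{n+1}$, where $\nabla_1,\nabla_2$ are gradients in the first and second variables of $U$. ''Without Fixman forces'' means the terms $\nabla_qV_{\mathrm{fix},\nu}$ are dropped. States satisfy $\xi(q_n)=z_n/\nu$ and $\nabla_q^T\xi(q_n)M^{-1}p_n=\frac1\nu M_z^{-1}p^z_n$, so $(z_n,p^z_n)$ is determined by $(q_n,p_n)$. ''Locally well-defined'' means the implicit equations for the constraints have a locally unique solution. *)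

(* Defs.v *)
From HB Require Import structures.
From mathcomp Require Import all_boot all_order all_algebra.
From mathcomp Require Import all_classical all_reals all_analysis.

Set Implicit Arguments.
Unset Strict Implicit.
Unset Printing Implicit Defensive.

Import Order.TTheory GRing.Theory Num.Theory.
Import numFieldNormedType.Exports.

Local Open Scope classical_set_scope.
Local Open Scope ring_scope.

Definition symmetric_posdef (R : realType) (m : nat) (A : 'M[R]_m) : Prop :=
  A^T = A /\ forall x : 'cV[R]_m, x != 0 -> 0 < (x^T *m A *m x) 0 0.

(* In finite dimension [Ck k f] is the usual "k times continuously
   differentiable", hence [smooth f] is C^oo. *)
Fixpoint Ck (R : realType) (E F : normedModType R) (k : nat) (f : E -> F)
    : Prop :=
  match k with
  | 0%N => continuous f
  | k'.+1 => (forall x, differentiable f x) /\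
             (forall v : E, Ck k' (fun x => 'D_v f x))
  end.

Definition smooth (R : realType) (E F : normedModType R) (f : E -> F) : Prop :=
  forall k, Ck k f.

Definition grad (R : realType) (m : nat) (f : 'cV[R]_m -> R) (x : 'cV[R]_m)
    : 'cV[R]_m :=
  \col_j 'D_(delta_mx j 0) f x.

(* Transposed Jacobian: entry (j, i) is the derivative of the i-th component of
   xi along the j-th coordinate, so that column i is the gradient of xi_i. *)
Definition gradm (R : realType) (d n : nat) (xi : 'cV[R]_d -> 'cV[R]_n)
    (x : 'cV[R]_d) : 'M[R]_(d, n) :=
  \matrix_(j, i) 'D_(delta_mx j 0) (fun y => xi y i 0) x.

Definition grad1 (R : realType) (d n : nat) (U : 'cV[R]_d * 'cV[R]_n -> R)
    (x : 'cV[R]_d) (y : 'cV[R]_n) : 'cV[R]_d := grad (fun x' => U (x', y)) x.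

Definition grad2 (R : realType) (d n : nat) (U : 'cV[R]_d * 'cV[R]_n -> R)
    (x : 'cV[R]_d) (y : 'cV[R]_n) : 'cV[R]_n := grad (fun y' => U (x, y')) y.

Definition penalized_mass (R : realType) (d n : nat) (M : 'M[R]_d)
    (Mz : 'M[R]_n) (xi : 'cV[R]_d -> 'cV[R]_n) (nu : R) (x : 'cV[R]_d)
    : 'M[R]_d :=
  M + nu ^+ 2 *: (gradm xi x *m Mz *m (gradm xi x)^T).

Definition Vfix (R : realType) (d n : nat) (M : 'M[R]_d) (Mz : 'M[R]_n)
    (beta : R) (xi : 'cV[R]_d -> 'cV[R]_n) (nu : R) (x : 'cV[R]_d) : R :=
  (2 * beta)^-1 * ln (\det (penalized_mass M Mz xi nu x)).

(* [fixman] tells whether the scheme is run with the Fixman forces. *)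
Definition grad_fix (R : realType) (d n : nat) (fixman : bool) (M : 'M[R]_d)
    (Mz : 'M[R]_n) (beta : R) (xi : 'cV[R]_d -> 'cV[R]_n) (nu : R)
    (x : 'cV[R]_d) : 'cV[R]_d :=
  if fixman then grad (Vfix M Mz beta xi nu) x else 0.

Record state (R : realType) (d n : nat) := State {
  pos : 'cV[R]_d;
  mom : 'cV[R]_d;
  zpos : 'cV[R]_n;
  zmom : 'cV[R]_n
}.

Definition on_constraints (R : realType) (d n : nat) (M : 'M[R]_d)
    (Mz : 'M[R]_n) (xi : 'cV[R]_d -> 'cV[R]_n) (nu : R) (s : state R d n)
    : Prop :=
  xi (pos s) = nu^-1 *: zpos s /\
  (gradm xi (pos s))^T *m invmx M *m mom s = nu^-1 *: (invmx Mz *m zmom s).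

(* A one-step relation: parameters nu and dt, current state, the multipliers
   lambda_{n+1/2} and lambda_{n+1}, next state. *)
Definition scheme (R : realType) (d n : nat) : Type :=
  R -> R -> state R d n -> 'cV[R]_n -> 'cV[R]_n -> state R d n -> Prop.

Definition schemeA (R : realType) (d n : nat) (fixman : bool) (M : 'M[R]_d)
    (Mz : 'M[R]_n) (beta : R) (V : 'cV[R]_d -> R)
    (xi : 'cV[R]_d -> 'cV[R]_n) : scheme R d n :=
  fun nu dt s l1 l2 s' =>
  let force x := grad V x + grad_fix fixman M Mz beta xi nu x in
  exists (ph : 'cV[R]_d) (pzh : 'cV[R]_n),
  [/\ ph = mom s - (dt / 2) *: force (pos s) - gradm xi (pos s) *m l1
    & pzh = zmom s + nu^-1 *: l1] /\
  [/\ pos s' = pos s + dt *: (invmx M *m ph),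
      zpos s' = zpos s + dt *: (invmx Mz *m pzh)
    & xi (pos s') = nu^-1 *: zpos s'] /\
  [/\ mom s' = ph - (dt / 2) *: force (pos s') - gradm xi (pos s') *m l2,
      zmom s' = pzh + nu^-1 *: l2
    & (gradm xi (pos s'))^T *m invmx M *m mom s'
      = nu^-1 *: (invmx Mz *m zmom s')].

Definition schemeB (R : realType) (d n : nat) (fixman : bool) (M : 'M[R]_d)
    (Mz : 'M[R]_n) (beta : R) (U : 'cV[R]_d * 'cV[R]_n -> R)
    (xi : 'cV[R]_d -> 'cV[R]_n) : scheme R d n :=
  fun nu dt s l1 l2 s' =>
  let force x := grad1 U x (xi x) + grad_fix fixman M Mz beta xi nu x in
  let zforce x := grad2 U x (xi x) in
  exists (ph : 'cV[R]_d) (pzh : 'cV[R]_n),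
  [/\ ph = mom s - (dt / 2) *: force (pos s) - gradm xi (pos s) *m l1
    & pzh = zmom s - (dt / (2 * nu)) *: zforce (pos s) + nu^-1 *: l1] /\
  [/\ pos s' = pos s + dt *: (invmx M *m ph),
      zpos s' = zpos s + dt *: (invmx Mz *m pzh)
    & xi (pos s') = nu^-1 *: zpos s'] /\
  [/\ mom s' = ph - (dt / 2) *: force (pos s') - gradm xi (pos s') *m l2,
      zmom s' = pzh - (dt / (2 * nu)) *: zforce (pos s') + nu^-1 *: l2
    & (gradm xi (pos s'))^T *m invmx M *m mom s'
      = nu^-1 *: (invmx Mz *m zmom s')].

(* A step whose multipliers lie in the ball of radius r.  The multipliers of
   the intended solution vanish with dt, whereas for nonlinear xi the implicit
   equation may have further solutions with multipliers of size unbounded as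
   dt -> 0; "the" solution is the one near 0. *)
Definition local_step (R : realType) (d n : nat) (r : R) (S : scheme R d n)
    (nu dt : R) (s : state R d n) (l : 'cV[R]_n * 'cV[R]_n)
    (s' : state R d n) : Prop :=
  [/\ `|l.1| <= r, `|l.2| <= r & S nu dt s l.1 l.2 s'].

(* Local unique solvability of the constraints, with nu = nubar * dt: for small
   time steps (uniformly on compact sets of (q, p)), exactly one pair of
   multipliers in the ball of radius r. *)
Definition locally_well_defined (R : realType) (d n : nat) (M : 'M[R]_d)
    (Mz : 'M[R]_n) (xi : 'cV[R]_d -> 'cV[R]_n) (nubar r : R)
    (S : scheme R d n) : Prop :=
  forall K : set ('cV[R]_d * 'cV[R]_d), compact K ->
  exists dt0 : R, 0 < dt0 /\
  forall dt : R, 0 < dt <= dt0 ->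
  forall s : state R d n, K (pos s, mom s) ->
  on_constraints M Mz xi (nubar * dt) s ->
  exists! l : 'cV[R]_n * 'cV[R]_n,
    exists s' : state R d n, local_step r S (nubar * dt) dt s l s'.

(* N steps of the scheme; [s k] is irrelevant for k > N. *)
Definition numerical_trajectory (R : realType) (d n : nat) (M : 'M[R]_d)
    (Mz : 'M[R]_n) (xi : 'cV[R]_d -> 'cV[R]_n) (r : R) (S : scheme R d n)
    (nu dt : R) (q0 p0 : 'cV[R]_d) (N : nat) (s : nat -> state R d n) : Prop :=
  [/\ pos (s 0%N) = q0, mom (s 0%N) = p0,
      on_constraints M Mz xi nu (s 0%N)
    & forall k, (k < N)%N ->
        exists l : 'cV[R]_n * 'cV[R]_n, local_step r S nu dt (s k) l (s k.+1)].

Definition hamiltonian_trajectory (R : realType) (d : nat) (M : 'M[R]_d)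
    (V : 'cV[R]_d -> R) (T : R) (q p : R -> 'cV[R]_d) : Prop :=
  [/\ {within `[0, T], continuous q}, {within `[0, T], continuous p}
    & forall t : R, 0 < t < T ->
        is_derive t (1 : R) q (invmx M *m p t) /\
        is_derive t (1 : R) p (- grad V (q t))].

(* C and dt0 may depend on the exact trajectory and on T, but not on the time
   step nor on the step index. *)
Definition converges_at_order2 (R : realType) (d n : nat) (M : 'M[R]_d)
    (Mz : 'M[R]_n) (V : 'cV[R]_d -> R) (xi : 'cV[R]_d -> 'cV[R]_n)
    (nubar r : R) (S : scheme R d n) : Prop :=
  forall (T : R) (q p : R -> 'cV[R]_d), 0 < T ->
  hamiltonian_trajectory M V T q p ->
  exists C dt0 : R, 0 < dt0 /\
  forall dt : R, 0 < dt <= dt0 ->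
  forall N : nat, N%:R * dt <= T ->
  let traj :=
    numerical_trajectory M Mz xi r S (nubar * dt) dt (q 0) (p 0) N in
  (exists s : nat -> state R d n, traj s) /\
  (forall s : nat -> state R d n, traj s ->
   forall k : nat, (k <= N)%N ->
     `|pos (s k) - q (k%:R * dt)| <= C * dt ^+ 2 /\
     `|mom (s k) - p (k%:R * dt)| <= C * dt ^+ 2).

(* Main.v *)
Require Import Defs.
From HB Require Import structures.
From mathcomp Require Import all_boot all_order all_algebra.
From mathcomp Require Import all_classical all_reals all_analysis.
From mathcomp Require Import ring lra.

Import Order.TTheory GRing.Theory Num.Theory.
Import numFieldNormedType.Exports.

Local Open Scope classical_set_scope.
Local Open Scope ring_scope.

Set Implicit Arguments.
Unset Strict Implicit.
Unset Printing Implicit Defensive.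

(** Over one step with [nu = nubar * dt] the position constraint reads
    [l1 = nubar^2 dt Mz (xi q' - xi q - dt G^T M^-1 p)], where [G = gradm xi q].
    Multipliers that are merely bounded thus satisfy [l1 = O(dt^2)], and feeding
    this back through a second-order Taylor expansion of [xi] gives
    [l1 = O(dt^3)].  The momentum constraint gives
    [l1 + l2 = nu^2 Mz (G'^T M^-1 p' - G^T M^-1 p)], so [l2 = O(dt^3)] in the same
    two passes.  Also [grad Vfix = O(nu^2)], because [det (M + nu^2 B)] is
    [det M + O(nu^2)] in C^1.  A step of (A) is therefore a velocity Verlet step
    for [V] up to [O(dt^3)], and a step of (B) is a step of (A) whose multipliers
    are shifted by [- dt/2 grad2 U].  Convergence follows from the local error of
    Verlet along the exact trajectory and a discrete Gronwall argument in a
    compact tube around it, where the local solvability also produces the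
    numerical trajectory. *)

(** * Matrix norms and C^k functions on balls *)

Section MatrixNorm.
Context {R : realType}.

Lemma mx_norm_entry m n (A : 'M[R]_(m, n)) i j : `|A i j| <= `|A|.
Proof.
rewrite [leRHS]/Num.Def.normr /= mx_normrE.
exact: (le_bigmax _ (fun ij => `|A ij.1 ij.2|) (i, j)).
Qed.

Lemma mx_norm_le m n (A : 'M[R]_(m, n)) (c : R) : 0 <= c ->
  (forall i j, `|A i j| <= c) -> `|A| <= c.
Proof.
by move=> c0 Ac; rewrite /Num.Def.normr /= mx_normrE bigmax_le// => -[i j] _.
Qed.

(** The norm is the largest absolute value of an entry; each entry of the product is a sum of [n]
    terms, so the inner dimension enters as a factor. *)
Lemma mx_norm_mul m n p (A : 'M[R]_(m, n)) (B : 'M[R]_(n, p)) :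
  `|A *m B| <= n%:R * `|A| * `|B|.
Proof.
apply: mx_norm_le => [|i j]; first by rewrite !mulr_ge0.
rewrite mxE (le_trans (ler_norm_sum _ _ _))//.
rewrite -mulrA -[X in X%:R * _]card_ord mulr_natl -sumr_const ler_sum// => k _.
by rewrite normrM ler_pM// mx_norm_entry.
Qed.

Lemma mx_norm_tr m n (A : 'M[R]_(m, n)) : `|A^T| = `|A|.
Proof.
apply/eqP; rewrite eq_le; apply/andP; split; apply: mx_norm_le => // i j.
  by rewrite mxE mx_norm_entry.
by have := mx_norm_entry A^T j i; rewrite mxE.
Qed.

(** Heine-Borel for row vectors, carried over to columns by transposition, which is a linear
    isometry. *)
Lemma compact_cball d (r : R) : compact [set x : 'cV[R]_d | `|x| <= r].
Proof.
have -> : [set x : 'cV[R]_d | `|x| <= r] =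
    trmx @` [set x : 'rV[R]_d | `|x| <= r].
  apply/seteqP; split => [x xr|_ [x xr <-]] /=.
    by exists x^T => /=; rewrite ?mx_norm_tr// trmxK.
  by rewrite mx_norm_tr.
have trL : linear (@trmx R 1 d).
  by move=> a x y; apply/matrixP => i j; rewrite !mxE.
apply: continuous_compact.
  apply: continuous_subspaceT => x.
  apply/(@cvgrPdist_lt _ _ _ (nbhs x) (nbhs_filter x)) => /= e e0.
  apply/nbhs_ballP; exists e => //= y.
  by rewrite -ball_normE /= -linearB /= mx_norm_tr.
apply: bounded_closed_compact.
  by exists r; split => [|M rM x /= xr]; rewrite ?num_real// (le_trans xr)// ltW.
apply: (@closed_comp _ _ (fun x : 'rV[R]_d => `|x|) [set y | y <= r]).
  by move=> x _; exact: norm_continuous.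
exact: closed_le.
Qed.

Lemma compact_image_bounded (T : topologicalType) (V : normedModType R)
    (f : T -> V) (A : set T) : {within A, continuous f} -> compact A ->
  exists2 C, 0 <= C & forall x, A x -> `|f x| <= C.
Proof.
move=> fc cA.
have /ex_strict_bound_gt0[k k0 fk] : bounded_set (f @` A).
  exact/compact_bounded/continuous_compact.
by exists k => [|x Ax]; [exact: ltW | exact/ltW/fk/imageP].
Qed.

Lemma continuous_cball_bounded d (V : normedModType R) (f : 'cV[R]_d -> V) r :
  continuous f -> exists2 C, 0 <= C & forall x, `|x| <= r -> `|f x| <= C.
Proof.
move=> fc; apply: (@compact_image_bounded _ _ f [set x | `|x| <= r]).
  exact: continuous_subspaceT.
exact: compact_cball.
Qed.

Lemma cball_family_bounded d (I : finType) (V : normedModType R)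
    (f : I -> 'cV[R]_d -> V) r : (forall i, continuous (f i)) ->
  exists2 C, 0 <= C & forall i x, `|x| <= r -> `|f i x| <= C.
Proof.
move=> fc.
have {}fc i : exists C, 0 <= C /\ forall x, `|x| <= r -> `|f i x| <= C.
  by have [C C0 fC] := continuous_cball_bounded r (fc i); exists C.
(* The sum of nonnegative constants dominates each of them, hence serves all indices at once. *)
have [C CP] := choice fc; exists (\sum_i C i).
  by apply: sumr_ge0 => i _; case: (CP i).
move=> i x xr; rewrite (bigD1 i)//= ler_wpDr//.
  by apply: sumr_ge0 => j _; case: (CP j).
by case: (CP i) => _; exact.
Qed.

Lemma col_delta d (v : 'cV[R]_d) : v = \sum_j v j 0 *: delta_mx j 0.
Proof.
by rewrite {1}(matrix_sum_delta v); apply: eq_bigr => j _; rewrite big_ord1.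
Qed.

End MatrixNorm.

(** * Derivatives along lines, Lipschitz and Taylor bounds on balls *)

Section Smoothness.
Context {R : realType}.

Lemma Ck_coord (E : normedModType R) m n k (f : E -> 'M[R]_(m, n)) i j :
  Ck k f -> Ck k (fun x => f x i j).
Proof.
elim: k f => [|k IH] f /=.
  by move=> fc x; exact: (continuous_comp (fc x) (@coord_continuous _ _ _ i j _)).
move=> [fd fk]; split => [x|v].
  exact: (differentiable_comp (fd x) (@differentiable_coord _ _ _ _ i j)).
have -> : (fun x => 'D_v (fun y => f y i j) x) = (fun x => ('D_v f x) i j).
  apply/funext => x; rewrite derive_mx ?mxE//.
  exact: diff_derivable.
exact: IH.
Qed.

Lemma smooth_derive (E F : normedModType R) (f : E -> F) v :
  smooth f -> smooth (fun x => 'D_v f x).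
Proof. by move=> fs k; case: (fs k.+1) => _; exact. Qed.

Lemma smooth_differentiable (E F : normedModType R) (f : E -> F) x :
  smooth f -> differentiable f x.
Proof. by move=> fs; case: (fs 1%N) => /(_ x). Qed.

Lemma smooth_continuous (E F : normedModType R) (f : E -> F) :
  smooth f -> continuous f.
Proof. by move=> fs; exact: (fs 0%N). Qed.

Lemma smooth_coord (E : normedModType R) m n (f : E -> 'M[R]_(m, n)) i j :
  smooth f -> smooth (fun x => f x i j).
Proof. by move=> fs k; exact: Ck_coord. Qed.

Lemma differentiable_line (E : normedModType R) (x v : E) (t : R) :
  differentiable (fun s : R => x + s *: v) t.
Proof.
apply: differentiableD; first exact: differentiable_cst.
exact: differentiableZl.
Qed.

Lemma is_derive_line (E F : normedModType R) (f : E -> F) (x v : E) (t : R) :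
  differentiable f (x + t *: v) ->
  is_derive t (1 : R) (fun s => f (x + s *: v)) ('D_v f (x + t *: v)).
Proof.
move=> fd; apply: DeriveDef.
  apply/derivable1_diffP.
  exact: (differentiable_comp (differentiable_line x v t) fd).
rewrite /derive; set g1 := fun h => h^-1 *: _; set g2 := fun h => h^-1 *: _.
suff -> : g1 = g2 by [].
apply/funext => h; rewrite /g1 /g2 /=; congr (_ *: (f _ - _)).
by rewrite [_%:A]mulr1 scalerDl addrCA.
Qed.

Lemma MVT_line (E : normedModType R) (f : E -> R) (x v : E) :
  (forall y, differentiable f y) ->
  exists2 t : R, 0 <= t <= 1 & f (x + v) - f x = 'D_v f (x + t *: v).
Proof.
move=> fd.
have [| |c c01] := @MVT_segment R (fun s => f (x + s *: v))
    (fun s => 'D_v f (x + s *: v)) 0 1 ler01.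
- by move=> s _; exact: is_derive_line.
- apply: continuous_subspaceT => s; apply: differentiable_continuous.
  exact: (differentiable_comp (differentiable_line x v s) (fd _)).
rewrite scale1r scale0r addr0 subr0 mulr1 => fE; exists c => //.
Qed.

Section Column.
Context {d : nat}.
Implicit Types (f : 'cV[R]_d -> R) (x v : 'cV[R]_d).

(** Linearity of the differential reduces every direction to finitely many partial derivatives,
    which can be bounded uniformly on a ball. *)
Lemma derive_col f x v : differentiable f x ->
  'D_v f x = \sum_j v j 0 * 'D_(delta_mx j 0) f x.
Proof.
move=> fd; rewrite deriveE// {1}(col_delta v) linear_sum; apply: eq_bigr => j _.
by rewrite linearZ /= deriveE.
Qed.

Lemma derive_le f x v (C : R) : differentiable f x ->
  (forall j, `|'D_(delta_mx j 0) f x| <= C) -> `|'D_v f x| <= d%:R * C * `|v|.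
Proof.
move=> fd fC; rewrite derive_col// (le_trans (ler_norm_sum _ _ _))//.
rewrite -mulrA -[X in X%:R * _]card_ord mulr_natl -sumr_const ler_sum// => j _.
by rewrite normrM mulrC ler_pM// mx_norm_entry.
Qed.

Lemma C1_derive_bound f r : Ck 1 f ->
  exists2 C, 0 <= C & forall x v, `|x| <= r -> `|'D_v f x| <= C * `|v|.
Proof.
move=> [fd fc].
have [C C0 fC] := @cball_family_bounded R d 'I_d R
  (fun j x => 'D_(delta_mx j 0) f x) r (fun j => fc _).
exists (d%:R * C) => [|x v xr]; first exact: mulr_ge0.
by apply: derive_le => // j; exact: fC.
Qed.

Lemma cball_convex (V : normedModType R) (x y : V) (r t : R) : 0 <= t <= 1 ->
  `|x| <= r -> `|y| <= r -> `|x + t *: (y - x)| <= r.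
Proof.
move=> /andP[t0 t1] xr yr.
have -> : x + t *: (y - x) = (1 - t) *: x + t *: y.
  by rewrite scalerBr scalerBl scale1r addrA addrAC.
rewrite (le_trans (ler_normD _ _))// !normrZ !ger0_norm ?subr_ge0//.
have -> : r = (1 - t) * r + t * r by ring.
by rewrite lerD// ler_wpM2l// subr_ge0.
Qed.

Lemma C1_lipschitz f r : Ck 1 f -> exists2 C, 0 <= C &
  forall x y, `|x| <= r -> `|y| <= r -> `|f y - f x| <= C * `|y - x|.
Proof.
move=> fC1; have [C C0 fC] := C1_derive_bound r fC1.
exists C => // x y xr yr; have [fd _] := fC1.
have [t t01] := MVT_line x (y - x) fd.
by rewrite [x + _]addrC subrK => ->; exact/fC/cball_convex.
Qed.

(** By the mean value theorem the remainder is a difference of derivatives in the direction [y - x]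
    at two points of the segment. The partial derivatives are Lipschitz on the ball, which yields
    the second factor of the square. *)
Lemma C2_taylor f r : Ck 2 f -> exists2 C, 0 <= C &
  forall x y, `|x| <= r -> `|y| <= r ->
    `|f y - f x - 'D_(y - x) f x| <= C * `|y - x| ^+ 2.
Proof.
move=> [fd fC1].
have {}fC1 (j : 'I_d) : exists C, 0 <= C /\ forall x y, `|x| <= r -> `|y| <= r ->
    `|'D_(delta_mx j 0) f y - 'D_(delta_mx j 0) f x| <= C * `|y - x|.
  by have [C C0 fC] := C1_lipschitz r (fC1 (delta_mx j 0)); exists C.
have [C CP] := choice fC1; have C0 j : 0 <= C j by case: (CP j).
exists (\sum_j C j) => [|x y xr yr]; first exact: sumr_ge0.
have [t t01] := MVT_line x (y - x) fd.
rewrite [x + _]addrC subrK => ->; rewrite !derive_col// -sumrB.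
rewrite (le_trans (ler_norm_sum _ _ _))// mulr_suml ler_sum// => j _.
rewrite -mulrBr normrM expr2 mulrCA ler_pM ?mx_norm_entry//.
have [_ /(_ x (x + t *: (y - x)) xr)] := CP j.
move=> /(_ (cball_convex t01 xr yr)) /le_trans; apply.
rewrite [x + _]addrC addrK normrZ ler_wpM2l// ler_piMl//.
by case/andP: t01 => t0 t1; rewrite ger0_norm.
Qed.

End Column.
End Smoothness.

(** * Estimates in powers of the time step and the Fixman force *)

(** A uniform Landau symbol: one constant serves every index in [P]. With whole steps as indices, it
    depends neither on the state nor on the time step. *)
Definition isO (R : realType) (T : Type) (P : set T) (h : T -> R) (k : nat)
    (V : normedModType R) (f : T -> V) : Prop :=
  exists2 C, 0 <= C & forall c, P c -> `|f c| <= C * h c ^+ k.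

Section BigO.
Context {R : realType} {T : Type} {P : set T} {h : T -> R}.
Hypothesis h01 : forall c, P c -> 0 <= h c <= 1.

Local Notation O := (isO P h).

Let h_ge0 c k : P c -> 0 <= h c ^+ k.
Proof. by move=> /h01 /andP[h0 _]; exact: exprn_ge0. Qed.

Lemma isO_eq k (V : normedModType R) (f g : T -> V) :
  O k f -> (forall c, P c -> f c = g c) -> O k g.
Proof. by move=> [C C0 fC] fg; exists C => // c Pc; rewrite -fg// fC. Qed.

Lemma isO_weaken k l (V : normedModType R) (f : T -> V) :
  (l <= k)%N -> O k f -> O l f.
Proof.
move=> lk [C C0 fC]; exists C => // c Pc; rewrite (le_trans (fC _ Pc))//.
by rewrite ler_wpM2l//; case/andP: (h01 Pc) => h0 h1; exact: ler_wiXn2l.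
Qed.

Lemma isO_bounded (V : normedModType R) (f : T -> V) C :
  (forall c, P c -> `|f c| <= C) -> O 0 f.
Proof.
(* [P] may be empty, in which case nothing forces [C] to be nonnegative. *)
move=> fC; exists (Num.max 0 C) => [|c Pc]; first by rewrite le_max lexx.
by rewrite expr0 mulr1 le_max fC// orbT.
Qed.

Lemma isO_cst (V : normedModType R) (a : V) : O 0 (fun=> a).
Proof. exact: (@isO_bounded _ _ `|a|). Qed.

Lemma isO0 k (V : normedModType R) : O k (fun=> 0 : V).
Proof. by exists 0 => // c Pc; rewrite normr0 mul0r. Qed.

Lemma isO_h : O 1 h.
Proof. by exists 1 => // c /h01/andP[h0 _]; rewrite ger0_norm ?mul1r. Qed.

Lemma isO_norm_le k (V W : normedModType R) (f : T -> V) (g : T -> W) a :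
  0 <= a -> (forall c, P c -> `|g c| <= a * `|f c|) -> O k f -> O k g.
Proof.
move=> a0 gf [C C0 fC]; exists (a * C) => [|c Pc]; first exact: mulr_ge0.
by rewrite (le_trans (gf _ Pc))// -mulrA ler_wpM2l// fC.
Qed.

Lemma isO_norm_leM k l (U V W : normedModType R) (e : T -> U) (f : T -> V)
    (g : T -> W) a : 0 <= a ->
  (forall c, P c -> `|g c| <= a * (`|e c| * `|f c|)) ->
  O k e -> O l f -> O (k + l) g.
Proof.
move=> a0 gef [C C0 eC] [D D0 fD].
exists (a * (C * D)) => [|c Pc]; first by rewrite !mulr_ge0.
rewrite (le_trans (gef _ Pc))// -mulrA ler_wpM2l// exprD mulrACA.
by rewrite ler_pM// ?eC ?fD.
Qed.

Lemma isON k (V : normedModType R) (f : T -> V) : O k f -> O k (fun c => - f c).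
Proof. by apply: (isO_norm_le ler01) => c _; rewrite normrN mul1r. Qed.

Lemma isOD k (V : normedModType R) (f g : T -> V) :
  O k f -> O k g -> O k (fun c => f c + g c).
Proof.
move=> [C C0 fC] [D D0 gD]; exists (C + D) => [|c Pc]; first exact: addr_ge0.
by rewrite (le_trans (ler_normD _ _))// mulrDl lerD// ?fC ?gD.
Qed.

Lemma isOB k (V : normedModType R) (f g : T -> V) :
  O k f -> O k g -> O k (fun c => f c - g c).
Proof. by move=> fO gO; apply: isOD => //; exact: isON. Qed.

Lemma isOZ k l (V : normedModType R) (a : T -> R) (f : T -> V) :
  O k a -> O l f -> O (k + l) (fun c => a c *: f c).
Proof. by apply: (isO_norm_leM ler01) => c _; rewrite normrZ mul1r. Qed.

Lemma isOM k l (f g : T -> R) : O k f -> O l g -> O (k + l) (fun c => f c * g c).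
Proof. exact: isOZ. Qed.

Lemma isO_mulmx k l m n p (A : T -> 'M[R]_(m, n)) (B : T -> 'M[R]_(n, p)) :
  O k A -> O l B -> O (k + l) (fun c => A c *m B c).
Proof.
apply: (@isO_norm_leM _ _ _ _ _ _ _ _ n%:R) => // c _.
by rewrite mulrA mx_norm_mul.
Qed.

Lemma isO_tr k m n (A : T -> 'M[R]_(m, n)) : O k A -> O k (fun c => (A c)^T).
Proof. by apply: (isO_norm_le ler01) => c _; rewrite mx_norm_tr mul1r. Qed.

Lemma isO_mx k m n (A : T -> 'M[R]_(m, n)) :
  (forall i j, O k (fun c => A c i j)) -> O k A.
Proof.
move=> AO.
have {}AO (ij : 'I_m * 'I_n) : exists C, 0 <= C /\
    forall c, P c -> `|A c ij.1 ij.2| <= C * h c ^+ k.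
  by have [C C0 AC] := AO ij.1 ij.2; exists C.
have [C CP] := choice AO; have C0 ij : 0 <= C ij by case: (CP ij).
exists (\sum_ij C ij) => [|c Pc]; first exact: sumr_ge0.
apply: mx_norm_le => [|i j]; first by rewrite mulr_ge0 ?h_ge0 ?sumr_ge0.
have [_ /(_ c Pc)/= /le_trans] := CP (i, j); apply.
rewrite ler_wpM2r ?h_ge0// (bigD1 (i, j))//= lerDl.
exact: sumr_ge0.
Qed.

End BigO.

(** * The Fixman force is quadratic in [nu] *)

Section FixmanForce.
Context {R : realType}.

(* Stable under sums and products, hence under determinants: this bounds the
   derivative of [det (M + nu^2 B)] without Jacobi's formula. *)
Definition C1near (T : Type) (P : set T) (h : T -> R) (E : normedModType R)
    (x : T -> E) (v : E) (k : nat) (a : R) (g : T -> E -> R) : Prop :=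
  [/\ forall c, P c -> differentiable (g c) (x c),
      isO P h k (fun c => g c (x c) - a)
    & isO P h k (fun c => 'D_v (g c) (x c))].

Section Calculus.
Context {T : Type} {P : set T} {h : T -> R}.
Hypothesis h01 : forall c, P c -> 0 <= h c <= 1.
Context {E : normedModType R} {x : T -> E} {v : E}.

Local Notation C1n := (C1near P h x v).

Lemma C1near_eq k a f g : C1n k a f -> (forall c y, f c y = g c y) -> C1n k a g.
Proof.
move=> fC fg; suff <- : f = g by [].
by apply/funext => c; apply/funext => y.
Qed.

Lemma C1near_cst k a : C1n k a (fun _ _ => a).
Proof.
split=> [c Pc||]; first exact: differentiable_cst.
- by apply: (isO_eq (isO0 k R)) => c _; rewrite subrr.
- by apply: (isO_eq (isO0 k R)) => c _; rewrite derive_cst.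
Qed.

Lemma C1nearD k a b f g : C1n k a f -> C1n k b g ->
  C1n k (a + b) (fun c y => f c y + g c y).
Proof.
move=> [fd fa f'] [gd gb g']; split=> [c Pc||].
- exact: (differentiableD (fd _ Pc) (gd _ Pc)).
- by apply: (isO_eq (isOD fa gb)) => c _; ring.
- apply: (isO_eq (isOD f' g')) => c Pc; apply/esym/deriveD;
    exact: diff_derivable (_ c Pc).
Qed.

Lemma C1nearM k a b f g : C1n k a f -> C1n k b g ->
  C1n k (a * b) (fun c y => f c y * g c y).
Proof.
(* Closeness to a constant implies boundedness, which is all the product rule asks of the
   undifferentiated factor. *)
have bd (u : T -> E -> R) e : C1n k e u -> isO P h 0 (fun c => u c (x c)).
  move=> [_ ue _]; have {}ue := isO_weaken h01 (leq0n k) ue.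
  by apply: (isO_eq (isOD ue (isO_cst e))) => // c _; rewrite subrK.
move=> fC gC; have [[fd fa f'] [gd gb g']] := (fC, gC).
split=> [c Pc||].
- exact: (differentiableM (fd _ Pc) (gd _ Pc)).
- have fg1 := isOM fa (bd _ _ gC); rewrite addn0 in fg1.
  by apply: (isO_eq (isOD fg1 (isOM (isO_cst a) gb))) => c _; ring.
- have fgO := isOD (isOM (bd _ _ fC) g') (isOM (bd _ _ gC) f').
  apply: (isO_eq fgO) => c Pc; apply/esym/deriveM;
    exact: diff_derivable (_ c Pc).
Qed.

Lemma C1near_sum k (I : Type) (r : seq I) (a : I -> R) (f : I -> T -> E -> R) :
  (forall i, C1n k (a i) (f i)) ->
  C1n k (\sum_(i <- r) a i) (fun c y => \sum_(i <- r) f i c y).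
Proof.
move=> fC; elim: r => [|i r IH]; rewrite (big_nil, big_cons).
  by apply: (C1near_eq (C1near_cst _ _)) => c y; rewrite big_nil.
by apply: (C1near_eq (C1nearD (fC i) IH)) => c y; rewrite big_cons.
Qed.

Lemma C1near_prod k (I : Type) (r : seq I) (a : I -> R) (f : I -> T -> E -> R) :
  (forall i, C1n k (a i) (f i)) ->
  C1n k (\prod_(i <- r) a i) (fun c y => \prod_(i <- r) f i c y).
Proof.
move=> fC; elim: r => [|i r IH]; rewrite (big_nil, big_cons).
  by apply: (C1near_eq (C1near_cst _ _)) => c y; rewrite big_nil.
by apply: (C1near_eq (C1nearM (fC i) IH)) => c y; rewrite big_cons.
Qed.

Lemma C1near_det k n (A : 'M[R]_n) (B : T -> E -> 'M[R]_n) :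
  (forall i j, C1n k (A i j) (fun c y => B c y i j)) ->
  C1n k (\det A) (fun c y => \det (B c y)).
Proof.
move=> AB; rewrite /determinant; apply: C1near_sum => s.
by apply: C1nearM; [exact: C1near_cst | exact: C1near_prod].
Qed.

End Calculus.

Lemma posdef_ker m (A : 'M[R]_m) (v : 'cV[R]_m) :
  (forall x : 'cV[R]_m, x != 0 -> 0 < (x^T *m A *m x) 0 0) -> A *m v = 0 -> v = 0.
Proof.
move=> Apos Av0; apply/eqP/negPn/negP => /Apos.
by rewrite -mulmxA Av0 mulmx0 mxE ltxx.
Qed.

Lemma posdef_unit m (A : 'M[R]_m) :
  (forall x : 'cV[R]_m, x != 0 -> 0 < (x^T *m A *m x) 0 0) -> A \in unitmx.
Proof.
move=> Apos; rewrite -unitmx_tr -row_free_unit; apply/row_freeP.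
exists (invmx A^T); rewrite mulmxV// unitmxE unitfE; apply/det0P => -[v v0 vA].
move: v0; rewrite -trmx_eq0 (posdef_ker Apos (v := v^T)) ?eqxx//.
by rewrite -[A]trmxK -trmx_mul vA trmx0.
Qed.

Lemma posdef_det_gt0 m (A : 'M[R]_m) :
  (forall x : 'cV[R]_m, x != 0 -> 0 < (x^T *m A *m x) 0 0) -> 0 < \det A.
Proof.
move=> Apos.
(* Along the segment from the identity to [A] the determinant never vanishes. *)
pose f (t : R) := \det ((1 - t) *: 1%:M + t *: A).
have f_neq0 t : 0 <= t <= 1 -> f t != 0.
  move=> /andP[t0 t1]; rewrite /f -unitfE -unitmxE; apply: posdef_unit => x x0.
  rewrite mulmxDr mulmxDl -!scalemxAr -!scalemxAl mulmx1 mxE.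
  rewrite [X in X + _]mxE [X in _ + X]mxE.
  have xx : 0 < (x^T *m x) 0 0.
    rewrite lt0r; apply/andP; split; last first.
      by rewrite mxE sumr_ge0// => i _; rewrite mxE -expr2 sqr_ge0.
    apply: contra x0 => /eqP; rewrite mxE => xx; apply/eqP/colP => i.
    rewrite mxE; move/eqP: xx; rewrite psumr_eq0; last first.
      by move=> j _; rewrite mxE -expr2 sqr_ge0.
    by move=> /allP/(_ i)/(_ (mem_index_enum _)); rewrite /= mxE mulf_eq0 orbb => /eqP.
  have [->|t_neq0] := eqVneq t 0; first by rewrite subr0 mul1r mul0r addr0.
  rewrite ltr_wpDl ?mulr_ge0 ?subr_ge0 ?(ltW xx)// mulr_gt0 ?Apos//.
  by rewrite lt0r t_neq0.
(* Along the segment the determinant is a polynomial in [t], so the intermediate value theorem for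
   polynomials applies: from the value 1 at the identity it cannot reach [\det A <= 0] without a
   root in the unit interval. *)
pose p : {poly R} :=
  \det (\matrix_(i, j) (((i == j)%:R)%:P * (1 - 'X) + (A i j)%:P * 'X)).
have pE t : p.[t] = f t.
  rewrite -[p.[t]]/(horner_eval t p) -det_map_mx; congr (\det _).
  apply/matrixP => i j; rewrite !mxE /= horner_evalE !hornerE /=; ring.
have f0 : f 0 = 1 by rewrite /f subr0 scale1r scale0r addr0 det1.
have f1 : f 1 = \det A by rewrite /f subrr scale0r scale1r add0r.
rewrite ltNge; apply/negP => A0.
have [||c c01] := @poly_ivt R (- p) 0 1; first exact: ler01.
  by rewrite !hornerN !pE f0 f1 oppr_le0 ler01 oppr_ge0.
by rewrite rootE hornerN oppr_eq0 pE; apply/negP/f_neq0.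
Qed.

(** The gradient of [ln \det] is the gradient of the determinant divided by the determinant. The
    numerator is quadratic in [nu] by the [C1near] calculus, and for small [nu] the denominator
    stays above [\det M / 2]. *)
Lemma grad_Vfix_bound d n (M : 'M[R]_d) (Mz : 'M[R]_n) (beta : R)
    (xi : 'cV[R]_d -> 'cV[R]_n) (r : R) : symmetric_posdef M -> smooth xi ->
  exists2 nu1, 0 < nu1 & exists2 C, 0 <= C & forall nu x,
    0 <= nu <= nu1 -> `|x| <= r ->
    `|grad (Vfix M Mz beta xi nu) x| <= C * nu ^+ 2.
Proof.
move=> [_ Mpos] xis; have detM := posdef_det_gt0 Mpos.
pose P := [set c : R * 'cV[R]_d | 0 <= c.1 <= 1 /\ `|c.2| <= r].
(* The mass matrix depends on [nu] only through its square, so the square is taken as small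
   parameter; order 1 in [h] is order 2 in [nu]. *)
pose h (c : R * 'cV[R]_d) := c.1 ^+ 2.
have h01 c : P c -> 0 <= h c <= 1.
  by move=> [/andP[c0 c1] _]; rewrite sqr_ge0 exprn_ile1.
pose W (c : R * 'cV[R]_d) y := penalized_mass M Mz xi c.1 y.
pose D (c : R * 'cV[R]_d) y := \det (W c y).
(* At order 0 with reference value 0, [C1near] asks only for differentiability and for bounds on
   value and derivative, which a smooth function has on the ball. *)
have C1n_smooth v (f : 'cV[R]_d -> R) : smooth f ->
    C1near P h snd v 0 0 (fun=> f).
  move=> fs; split => [c _||]; first exact: smooth_differentiable.
    have [C C0 fC] := continuous_cball_bounded r (smooth_continuous fs).
    by apply: (isO_bounded (C := C)) => c [_ cr]; rewrite subr0 fC.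
  have [C C0 fC] := continuous_cball_bounded r
    (smooth_continuous (smooth_derive v fs)).
  by apply: (isO_bounded (C := C)) => c [_ cr]; rewrite fC.
have DC v : C1near P h snd v 1 (\det M) D.
  apply: (C1near_det h01) => i j.
  have C1B : C1near P h snd v 0 0
      (fun _ y => (gradm xi y *m Mz *m (gradm xi y)^T) i j).
    have C1G a b : C1near P h snd v 0 0 (fun _ y => gradm xi y a b).
      apply: (C1near_eq (C1n_smooth v _ _)) => [|c y]; last by rewrite mxE.
      exact/smooth_derive/smooth_coord.
    have C1GM k : C1near P h snd v 0 0 (fun _ y => (gradm xi y *m Mz) i k).
      have := C1near_sum (index_enum 'I_n) (fun l =>
        C1nearM h01 (C1G i l) (C1near_cst 0 (Mz l k))).
      under eq_bigr do rewrite mul0r.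
      by rewrite big1// => H; apply: (C1near_eq H) => c y; rewrite mxE.
    have := C1near_sum (index_enum 'I_n) (fun k =>
      C1nearM h01 (C1GM k) (C1G j k)).
    rewrite big1 => [H|k _]; last by rewrite mul0r.
    apply: (C1near_eq H) => c y; rewrite mxE; apply: eq_bigr => k _.
    by rewrite [X in _ = _ * X]mxE.
  have [Bd BO B'O] := C1B.
  (* The factor [h c] is constant in [y]; it lifts the bounded entries of the added matrix from
     order 0 to order 1. *)
  suff WC : C1near P h snd v 1 (M i j)
      (fun c y => M i j + h c * (gradm xi y *m Mz *m (gradm xi y)^T) i j).
    apply: (C1near_eq WC) => c y.
    by rewrite /W /penalized_mass [RHS]mxE [X in _ = _ + X]mxE.
  split=> [c Pc||].
  - apply: differentiableD; first exact: differentiable_cst.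
    exact: (differentiableZ (h c) (Bd _ Pc)).
  - by apply: (isO_eq (isOM (isO_h h01) BO)) => c Pc; rewrite subr0; ring.
  - apply: (isO_eq (isOM (isO_h h01) B'O)) => c Pc.
    have dB := @diff_derivable _ _ _ _ _ v (Bd _ Pc).
    rewrite (deriveD (derivable_cst _ _ _) (derivableZ dB)) derive_cst add0r.
    exact/esym/deriveZ.
(* The estimate of the value does not involve the direction, so the direction 0 will do. *)
have [C1 C10 DC1] : isO P h 1 (fun c => D c c.2 - \det M).
  by case: (DC 0).
(* As [nu <= 1] gives [nu ^+ 2 <= nu], this threshold ensures [C1 * nu ^+ 2 <= \det M / 2]; the
   added 1 avoids a division by zero. *)
pose t1 := Num.min 1 (\det M / 2 / (C1 + 1)).
have t10 : 0 < t1 by rewrite lt_min ltr01 !divr_gt0// ltr_wpDl.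
have Dlow c : P c -> c.1 <= t1 -> \det M / 2 <= D c c.2.
  move=> Pc; rewrite le_min => /andP[c1 ct1]; case: (Pc) => /andP[c0 _] _.
  have C1h : C1 * h c ^+ 1 <= \det M / 2.
    rewrite expr1 (@le_trans _ _ ((C1 + 1) * c.1))//.
      by rewrite ler_pM ?sqr_ge0 ?lerDl// /h expr2 ler_piMl.
    by rewrite mulrC -ler_pdivlMr// ltr_wpDl.
  have := le_trans (DC1 c Pc) C1h; rewrite ler_norml => /andP[+ _]; lra.
have Dd c : P c -> differentiable (D c) c.2 by case: (DC 0) => + _ _; exact.
have {}DC (j : 'I_d) : exists C, 0 <= C /\ forall c, P c ->
    `|'D_(delta_mx j 0) (D c) c.2| <= C * c.1 ^+ 2.
  by have [_ _ [C C0 DC']] := DC (delta_mx j 0); exists C.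
have [C CP] := choice DC; have C0 j : 0 <= C j by case: (CP j).
exists t1 => //; exists ((2 * `|beta|)^-1 * (\det M / 2)^-1 * (\sum_j C j)).
  by rewrite !mulr_ge0 ?invr_ge0 ?sumr_ge0// divr_ge0// ltW.
move=> nu x /andP[nu0 nu1] xr; apply: mx_norm_le => [|j i].
  rewrite mulr_ge0 ?sqr_ge0// !mulr_ge0 ?invr_ge0 ?sumr_ge0//.
  by rewrite divr_ge0// ltW.
have Pc : P (nu, x).
  by split => //=; rewrite nu0 (le_trans nu1)// ge_min lexx.
have Dl := Dlow (nu, x) Pc nu1; rewrite /= in Dl.
have Dx0 : 0 < D (nu, x) x by rewrite (lt_le_trans _ Dl)// divr_gt0.
rewrite mxE.
have lnD : 'D_(delta_mx j 0) (Vfix M Mz beta xi nu) x =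
    (2 * beta)^-1 * ((D (nu, x) x)^-1 * 'D_(delta_mx j 0) (D (nu, x)) x).
  have Dx := Dd _ Pc; have /(is_derive1_ln) lnx := Dx0.
  have lnd : differentiable (@ln R) (D (nu, x) x).
    by apply/derivable1_diffP; exact: ex_derive.
  have lnDd : differentiable (@ln R \o D (nu, x)) x.
    exact: (differentiable_comp Dx lnd).
  rewrite (_ : Vfix _ _ _ _ _ = (2 * beta)^-1 *: (@ln R \o D (nu, x)))//.
  rewrite deriveZ; last exact: diff_derivable.
  congr (_ * _); rewrite !deriveE// diff_comp//=.
  by rewrite deriv1E/= ?derive1E ?derive_val// mulrC.
rewrite lnD !normrM normfV normrM [`|2|]ger0_norm// -!mulrA.
rewrite ler_wpM2l ?invr_ge0 ?mulr_ge0// normfV (gtr0_norm Dx0).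
rewrite ler_pM ?invr_ge0 ?(ltW Dx0)//.
  by rewrite lef_pV2 ?posrE// divr_gt0.
have [_ /(_ _ Pc)/= /le_trans] := CP j; apply.
rewrite ler_wpM2r ?sqr_ge0// (bigD1 j)//= lerDl.
exact: sumr_ge0.
Qed.

End FixmanForce.

(** * One step of scheme (A) *)

Section StepEstimate.
Context {R : realType}.

(** * Landau estimates for smooth maps along families of points *)

Section Composition.
Context {T : Type} {P : set T} {h : T -> R}.
Hypothesis h01 : forall c, P c -> 0 <= h c <= 1.
Context {d : nat} {r : R}.
Implicit Types (f : 'cV[R]_d -> R) (x y : T -> 'cV[R]_d).

Lemma isO_smooth_bounded f x : smooth f -> (forall c, P c -> `|x c| <= r) ->
  isO P h 0 (fun c => f (x c)).
Proof.
move=> fs xr; have [C _ fC] := continuous_cball_bounded r (smooth_continuous fs).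
by apply: (isO_bounded (C := C)) => c Pc; exact/fC/xr.
Qed.

Lemma isO_smooth_lipschitz k f x y : smooth f ->
  (forall c, P c -> `|x c| <= r) -> (forall c, P c -> `|y c| <= r) ->
  isO P h k (fun c => y c - x c) -> isO P h k (fun c => f (y c) - f (x c)).
Proof.
move=> fs xr yr; have [C C0 fC] := C1_lipschitz r (fs 1%N).
by apply: (isO_norm_le C0) => c Pc; apply: fC; [exact: xr | exact: yr].
Qed.

Lemma isO_smooth_taylor k f x y : smooth f ->
  (forall c, P c -> `|x c| <= r) -> (forall c, P c -> `|y c| <= r) ->
  isO P h k (fun c => y c - x c) ->
  isO P h (k + k) (fun c => f (y c) - f (x c) - 'D_(y c - x c) f (x c)).
Proof.
move=> fs xr yr yx; have [C C0 fC] := C2_taylor r (fs 2%N).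
apply: (isO_norm_leM C0 _ yx yx) => c Pc; rewrite -expr2.
by apply: fC; [exact: xr | exact: yr].
Qed.

Lemma isO_grad_bounded f x : smooth f -> (forall c, P c -> `|x c| <= r) ->
  isO P h 0 (fun c => grad f (x c)).
Proof.
move=> fs xr; apply: (isO_mx h01) => i j.
apply: (isO_eq (isO_smooth_bounded (smooth_derive (delta_mx i 0) fs) xr)) => c _.
by rewrite mxE.
Qed.

Lemma isO_gradm_bounded n (xi : 'cV[R]_d -> 'cV[R]_n) x : smooth xi ->
  (forall c, P c -> `|x c| <= r) -> isO P h 0 (fun c => gradm xi (x c)).
Proof.
move=> xis xr; apply: (isO_mx h01) => i j.
have fs := smooth_derive (delta_mx i 0) (smooth_coord j 0 xis).
by apply: (isO_eq (isO_smooth_bounded fs xr)) => c _; rewrite mxE.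
Qed.

Lemma isO_gradm_lipschitz k n (xi : 'cV[R]_d -> 'cV[R]_n) x y : smooth xi ->
  (forall c, P c -> `|x c| <= r) -> (forall c, P c -> `|y c| <= r) ->
  isO P h k (fun c => y c - x c) ->
  isO P h k (fun c => gradm xi (y c) - gradm xi (x c)).
Proof.
move=> xis xr yr yx; apply: (isO_mx h01) => i j.
have fs := smooth_derive (delta_mx i 0) (smooth_coord j 0 xis).
by apply: (isO_eq (isO_smooth_lipschitz fs xr yr yx)) => c _; rewrite !mxE.
Qed.

Lemma isO_map_lipschitz k n (xi : 'cV[R]_d -> 'cV[R]_n) x y : smooth xi ->
  (forall c, P c -> `|x c| <= r) -> (forall c, P c -> `|y c| <= r) ->
  isO P h k (fun c => y c - x c) -> isO P h k (fun c => xi (y c) - xi (x c)).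
Proof.
move=> xis xr yr yx; apply: (isO_mx h01) => i j.
have fs := smooth_coord i j xis.
by apply: (isO_eq (isO_smooth_lipschitz fs xr yr yx)) => c _; rewrite !mxE.
Qed.

Lemma isO_map_taylor k n (xi : 'cV[R]_d -> 'cV[R]_n) x y : smooth xi ->
  (forall c, P c -> `|x c| <= r) -> (forall c, P c -> `|y c| <= r) ->
  isO P h k (fun c => y c - x c) ->
  isO P h (k + k)
    (fun c => xi (y c) - xi (x c) - (gradm xi (x c))^T *m (y c - x c)).
Proof.
move=> xis xr yr yx; apply: (isO_mx h01) => i j.
have fs := smooth_coord i j xis.
apply: (isO_eq (isO_smooth_taylor fs xr yr yx)) => c _; rewrite (ord1 j).
rewrite derive_col; last exact/smooth_differentiable/smooth_coord.
rewrite ![in RHS]mxE; congr (_ - _); apply: eq_bigr => l _.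
by rewrite !mxE mulrC.
Qed.

End Composition.

(** The constraints at both ends eliminate the half-step values and the pair [z], [p^z]. The
    multipliers become explicit in the increments of [q] and [p], with small prefactors obtained by
    inverting [dt / nu^2 = 1 / (nubar^2 dt)] and [1 / nu^2]. *)
Lemma schemeA_equations d n fixman (M : 'M[R]_d) (Mz : 'M[R]_n) beta V
    (xi : 'cV[R]_d -> 'cV[R]_n) (nubar dt : R) (s s' : state R d n) l1 l2 :
  Mz \in unitmx -> nubar != 0 -> dt != 0 ->
  on_constraints M Mz xi (nubar * dt) s ->
  schemeA fixman M Mz beta V xi (nubar * dt) dt s l1 l2 s' ->
  let F x := grad V x + grad_fix fixman M Mz beta xi (nubar * dt) x in
  let G := gradm xi (pos s) in let G' := gradm xi (pos s') in
  [/\ pos s' - pos s =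
        dt *: (invmx M *m (mom s - (dt / 2) *: F (pos s) - G *m l1)),
      l1 = (nubar ^+ 2 * dt) *: (Mz *m (xi (pos s') - xi (pos s)
             - dt *: (G^T *m (invmx M *m mom s)))),
      mom s' - mom s = - (G *m l1) - (dt / 2) *: F (pos s)
        - (dt / 2) *: F (pos s') - G' *m l2,
      l1 + l2 = (nubar ^+ 2 * dt ^+ 2) *: (Mz *m (G'^T *m (invmx M *m mom s')
             - G^T *m (invmx M *m mom s)))
    & on_constraints M Mz xi (nubar * dt) s'].
Proof.
move=> Mzu nubar0 dt0 [xiq Gp] [ph [pzh [[phE pzhE] [[q'E z'E xiq'] [p'E pz'E Gp']]]]].
move=> F G G'; split.
- by rewrite q'E phE addrAC subrr add0r.
- have -> : xi (pos s') - xi (pos s) - dt *: (G^T *m (invmx M *m mom s)) =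
      (nubar ^+ 2 * dt)^-1 *: (invmx Mz *m l1).
    rewrite xiq' z'E xiq pzhE mulmxA Gp mulmxDr -scalemxAr.
    move: (invmx Mz *m zmom s) (invmx Mz *m l1) (zpos s) => b a z.
    by apply/colP => i; rewrite !mxE; field; rewrite dt0.
  rewrite -scalemxAr scalerA divff ?scale1r ?mulKVmx//.
  by rewrite mulf_neq0// expf_neq0.
- rewrite p'E phE.
  rewrite /F; move: (grad V (pos s)) (grad V (pos s')) (grad_fix _ _ _ _ _ _ (pos s)).
  move: (grad_fix _ _ _ _ _ _ (pos s')) (G *m l1) (G' *m l2) (mom s).
  move=> g' a b p f f' g.
  by apply/colP => i; rewrite !mxE; ring.
- have -> : G'^T *m (invmx M *m mom s') - G^T *m (invmx M *m mom s) =
      (nubar ^+ 2 * dt ^+ 2)^-1 *: (invmx Mz *m (l1 + l2)).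
    rewrite !mulmxA Gp' Gp pz'E pzhE !mulmxDr -!scalemxAr.
    move: (invmx Mz *m zmom s) (invmx Mz *m l1) (invmx Mz *m l2) => b a a'.
    by apply/colP => i; rewrite !mxE; field; rewrite dt0.
  rewrite -scalemxAr scalerA divff ?scale1r ?mulKVmx//.
  by rewrite mulf_neq0// expf_neq0.
- by split.
Qed.

(* The index type of the [isO] estimates, with [dt_] as the small parameter. *)
Record stepA d n := StepA {
  dt_ : R; src : state R d n; lam1 : 'cV[R]_n; lam2 : 'cV[R]_n;
  tgt : state R d n }.

Section Estimates.
Context {d n : nat} {fixman : bool} {M : 'M[R]_d} {Mz : 'M[R]_n} {beta : R}.
Context {V : 'cV[R]_d -> R} {xi : 'cV[R]_d -> 'cV[R]_n} {nubar : R}.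
Hypotheses (Mpos : symmetric_posdef M) (Mzpos : symmetric_posdef Mz).
Hypotheses (Vs : smooth V) (xis : smooth xi) (nubar0 : 0 < nubar).

(** The bound [rb] on the multipliers may vary with the position because the multipliers of (B),
    rewritten as multipliers of (A), are shifted by a position-dependent force. *)
Definition valid_stepA (r : R) (rb : 'cV[R]_d -> R) : set (stepA d n) := [set c |
  [/\ 0 < dt_ c <= 1, `|pos (src c)| <= r /\ `|mom (src c)| <= r,
      on_constraints M Mz xi (nubar * dt_ c) (src c)
    & [/\ `|lam1 c| <= rb (pos (src c)), `|lam2 c| <= rb (pos (tgt c))
      & schemeA fixman M Mz beta V xi (nubar * dt_ c) (dt_ c)
          (src c) (lam1 c) (lam2 c) (tgt c)]]].

Lemma valid_stepA_dt01 r rb c : valid_stepA r rb c -> 0 <= dt_ c <= 1.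
Proof. by case=> /andP[/ltW-> ->]. Qed.

Lemma valid_stepA_equations r rb c : valid_stepA r rb c ->
  let dt := dt_ c in let q := pos (src c) in let q' := pos (tgt c) in
  let p := mom (src c) in let p' := mom (tgt c) in
  let F x := grad V x + grad_fix fixman M Mz beta xi (nubar * dt) x in
  let G := gradm xi q in let G' := gradm xi q' in
  [/\ q' - q = dt *: (invmx M *m (p - (dt / 2) *: F q - G *m lam1 c)),
      lam1 c = (nubar ^+ 2 * dt) *: (Mz *m (xi q' - xi q
                 - dt *: (G^T *m (invmx M *m p)))),
      p' - p = - (G *m lam1 c) - (dt / 2) *: F q - (dt / 2) *: F q'
               - G' *m lam2 c,
      lam1 c + lam2 c = (nubar ^+ 2 * dt ^+ 2) *: (Mz *m (
                 G'^T *m (invmx M *m p') - G^T *m (invmx M *m p)))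
    & on_constraints M Mz xi (nubar * dt) (tgt c)].
Proof.
case=> /andP[dt0 _] _ con [_ _ step].
exact: (schemeA_equations (posdef_unit Mzpos.2) (lt0r_neq0 nubar0)
  (lt0r_neq0 dt0) con step).
Qed.

(** With [nu = nubar * dt] the bound quadratic in [nu] becomes quadratic in [dt], once [nubar * dt]
    is below the threshold of [grad_Vfix_bound]. *)
Lemma isO_grad_fix (P : set (stepA d n)) r (x : stepA d n -> 'cV[R]_d) :
  (forall c, P c -> 0 <= dt_ c <= 1) -> (forall c, P c -> `|x c| <= r) ->
  exists2 dt1, 0 < dt1 & isO (P `&` [set c | dt_ c <= dt1]) (@dt_ d n) 2
    (fun c => grad_fix fixman M Mz beta xi (nubar * dt_ c) (x c)).
Proof.
move=> dt01 xr; rewrite /grad_fix; case: fixman; last first.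
  by exists 1 => //; exact: isO0.
have [nu1 nu10 [C C0 gC]] := grad_Vfix_bound Mz beta r Mpos xis.
exists (nu1 / nubar); first exact: divr_gt0.
exists (C * nubar ^+ 2) => [|c [Pc /= cdt]].
  by rewrite mulr_ge0 ?sqr_ge0.
rewrite -mulrA -exprMn gC ?xr//.
have /andP[dt0 _] := dt01 _ Pc.
by rewrite mulr_ge0 ?(ltW nubar0)//= mulrC -ler_pdivlMr.
Qed.

(** This has to come first: the forces and the multiplier bound at the new position can be
    controlled only once that position is confined to a ball. The increment itself involves data at
    the old position only. *)
Lemma stepA_position_increment r rb :
  (forall r, exists C, forall x, `|x| <= r -> rb x <= C) -> exists2 dt1, 0 < dt1 &
  isO (valid_stepA r rb `&` [set c | dt_ c <= dt1]) (@dt_ d n) 1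
    (fun c => pos (tgt c) - pos (src c)).
Proof.
move=> rbC; have posr c : valid_stepA r rb c -> `|pos (src c)| <= r by case=> _ [].
have [dt1 dt10 fixO] := isO_grad_fix (@valid_stepA_dt01 r rb) posr.
exists dt1 => //; set P := _ `&` _ in fixO *.
have {}posr c : P c -> `|pos (src c)| <= r by case=> /posr.
have h01 c : P c -> 0 <= dt_ c <= 1 by case=> /valid_stepA_dt01.
have gO := isO_grad_bounded h01 Vs posr.
have FO := isOD gO (isO_weaken h01 (leq0n _) fixO).
have l1O : isO P (@dt_ d n) 0 (@lam1 d n).
  have [C rC] := rbC r; apply: (isO_bounded (C := C)) => c Pc.
  by have [[_ _ _ [/le_trans + _ _]] _] := Pc; apply; exact/rC/posr.
have GO := isO_gradm_bounded h01 xis posr.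
have pO : isO P (@dt_ d n) 0 (fun c => mom (src c)).
  by apply: (isO_bounded (C := r)) => c [[_ []]].
have hO := isO_h h01.
have h2O : isO P (@dt_ d n) 0 (fun c => dt_ c / 2).
  exact: (isO_weaken h01 (leq0n _) (isOM hO (isO_cst (2^-1 : R)))).
have := isOZ hO (isO_mulmx (isO_cst (invmx M))
  (isOB (isOB pO (isOZ h2O FO)) (isO_mulmx GO l1O))).
move=> qO; apply: (isO_eq qO) => c [Pc _].
by have [-> _ _ _ _] := valid_stepA_equations Pc.
Qed.

Lemma stepA_estimate r rb :
  (forall r, exists C, forall x, `|x| <= r -> rb x <= C) ->
  exists2 dt1, 0 < dt1 & exists2 C, 0 <= C &
  forall dt, 0 < dt <= dt1 ->
  forall s s' l1 l2, `|pos s| <= r -> `|mom s| <= r ->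
  on_constraints M Mz xi (nubar * dt) s ->
  `|l1| <= rb (pos s) -> `|l2| <= rb (pos s') ->
  schemeA fixman M Mz beta V xi (nubar * dt) dt s l1 l2 s' ->
  [/\ on_constraints M Mz xi (nubar * dt) s',
      `|pos s' - (pos s + dt *: (invmx M *m (mom s - (dt / 2) *: grad V (pos s))))|
         <= C * dt ^+ 3
    & `|mom s' - (mom s - (dt / 2) *: (grad V (pos s) + grad V (pos s')))|
         <= C * dt ^+ 3].
Proof.
move=> rbC; have [dt1 dt10 [Cq Cq0 qC]] := stepA_position_increment r rbC.
pose P1 := valid_stepA r rb `&` [set c | dt_ c <= dt1].
(* Since [dt <= 1], the ball of radius [r1] contains both ends of the step. *)
pose r1 := r + Cq.
have posr1 c : P1 c -> `|pos (src c)| <= r1.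
  by case=> -[_ [posr _] _ _] _; rewrite (le_trans posr)// lerDl.
have posr1' c : P1 c -> `|pos (tgt c)| <= r1.
  move=> Pc; rewrite -[pos (tgt c)](subrK (pos (src c))) addrC.
  rewrite (le_trans (ler_normD _ _))//; case: (Pc) => -[_ [posr _] _ _] _.
  rewrite lerD// (le_trans (qC _ Pc))// expr1 ler_piMr//.
  by case: Pc => /valid_stepA_dt01/andP[].
have P1_01 c : P1 c -> 0 <= dt_ c <= 1 by case=> /valid_stepA_dt01.
have [dt2 dt20 fixO] := isO_grad_fix P1_01 posr1.
have [dt3 dt30 fixO'] := isO_grad_fix P1_01 posr1'.
pose dt4 := Num.min 1 (Num.min dt1 (Num.min dt2 dt3)).
pose P := P1 `&` [set c | dt_ c <= dt4].
have sub (V' : normedModType R) k (f : stepA d n -> V') a : dt4 <= a ->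
    isO (P1 `&` [set c | dt_ c <= a]) (@dt_ d n) k f -> isO P (@dt_ d n) k f.
  move=> dt4a [C C0 fC]; exists C => // c [P1c /= cdt]; apply: fC; split => //=.
  exact: le_trans cdt dt4a.
have {}fixO := sub _ _ _ _ _ fixO.
have {}fixO' := sub _ _ _ _ _ fixO'.
rewrite /dt4 !ge_min !lexx !orbT in fixO fixO'.
have {fixO} fixO := fixO isT; have {fixO'} fixO' := fixO' isT.
have {}posr1 c : P c -> `|pos (src c)| <= r1 by case=> /posr1.
have {}posr1' c : P c -> `|pos (tgt c)| <= r1 by case=> /posr1'.
have h01 c : P c -> 0 <= dt_ c <= 1 by case=> /P1_01.
have eqs c : P c -> _ := fun Pc => valid_stepA_equations Pc.1.1.
have l1O0 : isO P (@dt_ d n) 0 (@lam1 d n).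
  have [C rC] := rbC r1; apply: (isO_bounded (C := C)) => c Pc.
  by have [[[_ _ _ [/le_trans + _ _]] _] _] := Pc; apply; exact/rC/posr1.
have l2O0 : isO P (@dt_ d n) 0 (@lam2 d n).
  have [C rC] := rbC r1; apply: (isO_bounded (C := C)) => c Pc.
  by have [[[_ _ _ [_ /le_trans + _]] _] _] := Pc; apply; exact/rC/posr1'.
have pO : isO P (@dt_ d n) 0 (fun c => mom (src c)).
  by apply: (isO_bounded (C := r)) => c [[[_ []]]].
have gO := isO_grad_bounded h01 Vs posr1.
have gO' := isO_grad_bounded h01 Vs posr1'.
have FO := isOD gO (isO_weaken h01 (leq0n _) fixO).
have FO' := isOD gO' (isO_weaken h01 (leq0n _) fixO').
have GO := isO_gradm_bounded h01 xis posr1.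
have GO' := isO_gradm_bounded h01 xis posr1'.
have hO := isO_h h01.
have h2O : isO P (@dt_ d n) 1 (fun c => dt_ c / 2).
  exact: (isOM hO (isO_cst (2^-1 : R))).
have MiO := isO_cst (P := P) (h := @dt_ d n) (invmx M).
have MzO := isO_cst (P := P) (h := @dt_ d n) Mz.
have qO : isO P (@dt_ d n) 1 (fun c => pos (tgt c) - pos (src c)).
  exists Cq => // c [[Pc cdt] _]; exact: qC.
have nuO : isO P (@dt_ d n) 1 (fun c => nubar ^+ 2 * dt_ c).
  exact: (isOM (isO_cst (nubar ^+ 2)) hO).
have nu2O : isO P (@dt_ d n) 2 (fun c => nubar ^+ 2 * dt_ c ^+ 2).
  apply: (isO_eq (isOM (isOM (isO_cst (nubar ^+ 2)) hO) hO)) => c _; ring.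
(* First pass: the increment of [xi] is only known to be of order 1, and the prefactor [dt] adds
   one. *)
have l1O2 : isO P (@dt_ d n) 2 (@lam1 d n).
  have GMpO := isO_mulmx (isO_tr GO) (isO_mulmx MiO pO).
  have := isOZ nuO (isO_mulmx MzO
    (isOB (isO_map_lipschitz h01 xis posr1 posr1' qO) (isOZ hO GMpO))).
  by move=> lO; apply: (isO_eq lO) => c /eqs [_ <-].
have dqO : isO P (@dt_ d n) 2
    (fun c => pos (tgt c) - pos (src c) - dt_ c *: (invmx M *m mom (src c))).
  have Gl1O := isO_weaken h01 (isT : 1 <= 2)%N (isO_mulmx GO l1O2).
  have := isOZ hO (isO_mulmx MiO (isOB (isON (isOZ h2O FO)) Gl1O)).
  move=> lO; apply: (isO_eq lO) => c /eqs [-> _ _ _ _].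
  rewrite -scalerBr -mulmxBr; congr (_ *: (_ *m _)).
  by rewrite [RHS]addrC !addrA addNr add0r.
(* Second pass: with the linear part cancelled by [dqO], the Taylor remainder and the deviation from
   [dt M^-1 p] are both of order 2. *)
have l1O3 : isO P (@dt_ d n) 3 (@lam1 d n).
  have := isOZ nuO (isO_mulmx MzO (isOD
    (isO_map_taylor h01 xis posr1 posr1' qO) (isO_mulmx (isO_tr GO) dqO))).
  move=> lO; apply: (isO_eq lO) => c /eqs [_ l1E _ _ _].
  rewrite {}[RHS]l1E; congr (_ *: (_ *m _)).
  move: (pos (tgt c) - pos (src c)) => dq.
  by rewrite mulmxBr addrA subrK -scalemxAr.
have p'O0 : isO P (@dt_ d n) 0 (fun c => mom (tgt c)).
  have h2O0 := isO_weaken h01 (leq0n _) h2O.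
  have := isOD pO (isOB (isOB (isOB (isON (isO_mulmx GO l1O0)) (isOZ h2O0 FO))
    (isOZ h2O0 FO')) (isO_mulmx GO' l2O0)).
  move=> pO'; apply: (isO_eq pO') => c /eqs [_ _ <- _ _].
  by rewrite addrC subrK.
(* The prefactor is now [dt ^+ 2], so boundedness of the bracket ([k = 0]) gives the first pass and
   first order ([k = 1]) the second. *)
have l12O k : isO P (@dt_ d n) k (fun c => (gradm xi (pos (tgt c)))^T
      *m (invmx M *m mom (tgt c))
      - (gradm xi (pos (src c)))^T *m (invmx M *m mom (src c))) ->
    isO P (@dt_ d n) (2 + k) (fun c => lam1 c + lam2 c).
  move=> bO; have lO := isOZ nu2O (isO_mulmx MzO bO).
  by apply: (isO_eq lO) => c /eqs [_ _ _ <-].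
have l2O2 : isO P (@dt_ d n) 2 (@lam2 d n).
  have GMpO := isO_mulmx (isO_tr GO) (isO_mulmx MiO pO).
  have GMpO' := isO_mulmx (isO_tr GO') (isO_mulmx MiO p'O0).
  have lO := isOB (l12O _ (isOB GMpO' GMpO)) l1O2.
  by apply: (isO_eq lO) => c _; rewrite addrC addKr.
have dpO : isO P (@dt_ d n) 1 (fun c => mom (tgt c) - mom (src c)).
  have w21 := isO_weaken h01 (isT : 1 <= 2)%N.
  have := isOB (isOB (isOB (isON (w21 _ _ (isO_mulmx GO l1O2))) (isOZ h2O FO))
    (isOZ h2O FO')) (w21 _ _ (isO_mulmx GO' l2O2)).
  by move=> lO; apply: (isO_eq lO) => c /eqs [_ _ <-].
have l2O3 : isO P (@dt_ d n) 3 (@lam2 d n).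
  have dGO := isO_gradm_lipschitz h01 xis posr1 posr1' qO.
  (* The bracket is split as [(G' - G)^T M^-1 p' + G^T M^-1 (p' - p)], both of order 1. *)
  have bO := isOD (isO_mulmx (isO_tr dGO) (isO_mulmx MiO p'O0))
    (isO_mulmx (isO_tr GO) (isO_mulmx MiO dpO)).
  have lO : isO P (@dt_ d n) (2 + 1) (fun c => lam1 c + lam2 c).
    apply: l12O; apply: (isO_eq bO) => c _.
    by rewrite linearB /= mulmxBl !mulmxBr addrA subrK.
  by apply: (isO_eq (isOB lO l1O3)) => c _; rewrite addrC addKr.
have [C1 C10 posO] : isO P (@dt_ d n) 3 (fun c => pos (tgt c) - (pos (src c)
    + dt_ c *: (invmx M *m (mom (src c) - (dt_ c / 2) *: grad V (pos (src c)))))).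
  have w42 := isO_weaken h01 (isT : 2 <= 3)%N.
  have := isOZ hO (isO_mulmx MiO (isOB (isON (w42 _ _ (isOZ h2O fixO)))
    (w42 _ _ (isO_mulmx GO l1O3)))).
  move=> lO; apply: (isO_eq lO) => c /eqs [qE _ _ _ _].
  rewrite opprD addrA {}qE -scalerBr -mulmxBr; congr (_ *: (_ *m _)).
  move: (grad V _) (grad_fix _ _ _ _ _ _ _) (gradm _ _ *m _) => g f a.
  move: (mom _) (dt_ c / 2) => p k; apply/colP => i; rewrite !mxE; ring.
have [C2 C20 momO] : isO P (@dt_ d n) 3 (fun c => mom (tgt c) - (mom (src c)
    - (dt_ c / 2) *: (grad V (pos (src c)) + grad V (pos (tgt c))))).
  have := isOB (isOB (isOB (isON (isO_mulmx GO l1O3)) (isOZ h2O fixO))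
    (isOZ h2O fixO')) (isO_mulmx GO' l2O3).
  move=> lO; apply: (isO_eq lO) => c /eqs [_ _ pE _ _].
  rewrite opprD addrA {}pE.
  move: (grad V (pos (src c))) (grad V (pos (tgt c))) => g g'.
  move: (grad_fix _ _ _ _ _ _ (pos (src c))) => f.
  move: (grad_fix _ _ _ _ _ _ (pos (tgt c))) => f'.
  move: (gradm _ (pos (src c)) *m _) (gradm _ (pos (tgt c)) *m _) => a b.
  move: (dt_ c / 2) => k; apply/colP => i; rewrite !mxE; ring.
have dt40 : 0 < dt4 by rewrite !lt_min ltr01 dt10 dt20.
exists dt4 => //; exists (C1 + C2); first exact: addr_ge0.
move=> dt /andP[dt0 dtle] s s' l1 l2 sr pr con l1r l2r step.
pose c := StepA dt s l1 l2 s'.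
have Pc : P c.
  move: (dtle); rewrite !le_min => /and4P[dt1' dt2' _ _].
  do 2!split => //; by split => //=; rewrite dt0.
have [_ _ _ _ con'] := eqs _ Pc; split => //.
  rewrite (le_trans (posO _ Pc))// ler_wpM2r ?lerDl//.
  by rewrite exprn_ge0// ltW.
rewrite (le_trans (momO _ Pc))// ler_wpM2r ?lerDr//.
by rewrite exprn_ge0// ltW.
Qed.

End Estimates.

End StepEstimate.

(** * Local error of the exact flow *)

Section ExactFlow.
Context {R : realType}.

Lemma MVT_bound (f df : R -> R) a b C : a <= b ->
  {within `[a, b], continuous f} ->
  (forall x, a < x < b -> is_derive x (1 : R) f (df x)) ->
  (forall x, a < x < b -> `|df x| <= C) -> `|f b - f a| <= C * (b - a).
Proof.
rewrite le_eqVlt => /predU1P[-> _ _ _|ab fc fd dfC].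
  by rewrite !subrr mulr0 normr0.
have fd' x : x \in `]a, b[%R -> is_derive x (1 : R) f (df x).
  by rewrite in_itv; exact: fd.
have [c cab ->] := MVT ab fd' fc.
rewrite normrM (@ger0_norm _ (b - a)) ?subr_ge0 ?(ltW ab)//.
rewrite ler_wpM2r ?subr_ge0 ?(ltW ab)// dfC//.
Qed.

Lemma is_derive_entry (E : normedModType R) m n (f : E -> 'M[R]_(m, n)) x v df
    i j : is_derive x v f df -> is_derive x v (fun y => f y i j) (df i j).
Proof.
move=> [fd <-]; apply: DeriveDef; first exact: (derivable_mxP _ _ _).1 fd i j.
by rewrite derive_mx// mxE.
Qed.

Lemma within_continuous_entry (A : set R) m n (f : R -> 'M[R]_(m, n)) i j :
  {within A, continuous f} -> {within A, continuous (fun y => f y i j)}.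
Proof.
by move=> fc x; exact: (continuous_comp (fc x) (@coord_continuous _ _ _ i j _)).
Qed.

Lemma within_continuousM (A : set R) (f g : R -> R) :
  {within A, continuous f} -> {within A, continuous g} ->
  {within A, continuous (fun x => f x * g x)}.
Proof. by move=> fc gc x; apply: cvgM; [exact: fc | exact: gc]. Qed.

Lemma MVT_bound_col m n (f df : R -> 'M[R]_(m, n)) a b C : a <= b -> 0 <= C ->
  {within `[a, b], continuous f} ->
  (forall x, a < x < b -> is_derive x (1 : R) f (df x)) ->
  (forall x, a < x < b -> `|df x| <= C) -> `|f b - f a| <= C * (b - a).
Proof.
move=> ab C0 fc fd dfC; apply: mx_norm_le => [|i j].
  by rewrite mulr_ge0 ?subr_ge0.
rewrite !mxE; apply: (@MVT_bound (fun x => f x i j) (fun x => df x i j)) => //.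
- exact: within_continuous_entry.
- by move=> x xab; apply: is_derive_entry; exact: fd.
- by move=> x xab; rewrite (le_trans (mx_norm_entry _ _ _)) ?dfC.
Qed.

Lemma is_derive_curve (E : normedModType R) (q : R -> E) (dq : E) (f : E -> R)
    (t : R) : is_derive t (1 : R) q dq -> differentiable f (q t) ->
  is_derive t (1 : R) (fun u => f (q u)) ('D_dq f (q t)).
Proof.
move=> [qd <-] fd; have qd' := (derivable1_diffP _ _).1 qd.
have fqd : differentiable (f \o q) t by exact: differentiable_comp.
apply: DeriveDef; first exact/derivable1_diffP.
by rewrite deriveE// diff_comp//= -[in LHS]deriveE// -deriveE.
Qed.

Lemma is_derive_shift_mul (t c s : R) :
  is_derive s (1 : R) (fun u => (u - t) * c) c.
Proof.
have ds := is_deriveB (is_derive_id s (1 : R)) (is_derive_cst t s (1 : R)).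
have := is_deriveM ds (is_derive_cst c s (1 : R)).
by move=> /is_derive_eq; apply; rewrite scaler0 add0r subr0 [_ *: _]mulr1.
Qed.

Lemma is_derive_shift_sqr (t c s : R) :
  is_derive s (1 : R) (fun u => (u - t) ^+ 2 * c) (2 * (s - t) * c).
Proof.
have ds := is_derive_shift_mul t 1 s.
have := is_deriveM (is_deriveM ds ds) (is_derive_cst c s (1 : R)).
have -> : (fun u => (u - t) ^+ 2 * c) =
    ((fun u => (u - t) * 1) * (fun u => (u - t) * 1)) * cst c.
  by apply/funext => u; rewrite -[RHS]/((u - t) * 1 * ((u - t) * 1) * c) !mulr1 expr2.
move=> /is_derive_eq; apply.
rewrite scaler0 add0r /GRing.scale /=; ring.
Qed.

Lemma continuous_shift_mul (t c : R) : continuous (fun u => (u - t) * c).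
Proof.
move=> s; apply/differentiable_continuous/derivable1_diffP.
exact: (@ex_derive _ _ _ _ _ _ _ (is_derive_shift_mul t c s)).
Qed.

Lemma continuous_shift_sqr (t c : R) : continuous (fun u => (u - t) ^+ 2 * c).
Proof.
move=> s; apply/differentiable_continuous/derivable1_diffP.
exact: (@ex_derive _ _ _ _ _ _ _ (is_derive_shift_sqr t c s)).
Qed.

Lemma mulmx_bound m n p (A : 'M[R]_(m, n)) : exists2 C, 0 <= C &
  forall B : 'M[R]_(n, p), `|A *m B| <= C * `|B|.
Proof.
exists (n%:R * `|A|); [exact: mulr_ge0 | by move=> B; exact: mx_norm_mul].
Qed.

Section Trajectory.
Context {d : nat} {M : 'M[R]_d} {V : 'cV[R]_d -> R} {T L : R}.
Context {q p : R -> 'cV[R]_d}.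
Hypotheses (Vs : smooth V) (ham : hamiltonian_trajectory M V T q p).
Hypotheses (L0 : 0 <= L).
Hypothesis gradL : forall x y, `|grad V y - grad V x| <= L * `|y - x|.

Lemma hamiltonian_bounded : exists2 B, 0 <= B &
  forall t, 0 <= t <= T -> `|q t| <= B /\ `|p t| <= B.
Proof.
have [qc pc _] := ham.
have [B1 B10 qB] := compact_image_bounded qc (@segment_compact _ 0 T).
have [B2 B20 pB] := compact_image_bounded pc (@segment_compact _ 0 T).
exists (B1 + B2) => [|t t0T]; first exact: addr_ge0.
have tT : `[0, T]%classic t by rewrite /= in_itv.
by split; [rewrite (le_trans (qB _ tT)) ?lerDl | rewrite (le_trans (pB _ tT)) ?lerDr].
Qed.

Let continuous_sub (f : R -> 'cV[R]_d) a b : 0 <= a -> b <= T ->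
  {within `[0, T], continuous f} -> {within `[a, b], continuous f}.
Proof.
by move=> a0 bT; apply: continuous_subspaceW; apply: subset_itv; rewrite bnd_simp.
Qed.

Lemma hamiltonian_lipschitz : exists2 C, 0 <= C & forall a b,
  0 <= a -> a <= b -> b <= T ->
  `|q b - q a| <= C * (b - a) /\ `|p b - p a| <= C * (b - a).
Proof.
have [m m0 norm_invmx] := mulmx_bound 1 (invmx M).
have [B B0 qpB] := hamiltonian_bounded; have [qc pc der] := ham.
(* [C1] bounds the velocity; [C2] bounds the force along the trajectory by comparison with its value
   at [q 0]. *)
pose C1 := m * B; pose C2 := `|grad V (q 0)| + L * (B + B).
have C10 : 0 <= C1 by exact: mulr_ge0.
have C20 : 0 <= C2 by rewrite addr_ge0 ?mulr_ge0 ?addr_ge0.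
exists (C1 + C2) => [|a b a0 ab bT]; first exact: addr_ge0.
have in0T x : a < x < b -> 0 < x < T.
  by move=> /andP[ax xb]; rewrite (le_lt_trans a0)// (lt_le_trans xb).
have T0 : 0 <= T by rewrite (le_trans a0)// (le_trans ab).
split; rewrite mulrDl.
  rewrite ler_wpDr ?mulr_ge0 ?subr_ge0//.
  apply: (MVT_bound_col (df := fun x => invmx M *m p x)) => //.
  - exact: continuous_sub qc.
  - by move=> x /in0T /der [].
  - move=> x /in0T /andP[x0 xT]; rewrite (le_trans (norm_invmx _))//.
    by rewrite ler_wpM2l//; apply: (qpB x _).2; rewrite !ltW.
rewrite ler_wpDl ?mulr_ge0 ?subr_ge0//.
apply: (MVT_bound_col (df := fun x => - grad V (q x))) => //.
- exact: continuous_sub pc.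
- by move=> x /in0T /der [].
- move=> x /in0T /andP[x0 xT]; rewrite normrN.
  rewrite -[grad V (q x)](subrK (grad V (q 0))) addrC.
  rewrite (le_trans (ler_normD _ _))// lerD2l (le_trans (gradL _ _))//.
  rewrite ler_wpM2l// (le_trans (ler_normB _ _))// lerD//.
    by apply: (qpB x _).1; rewrite !ltW.
  by apply: (qpB 0 _).1; rewrite lexx.
Qed.

(** The position is expanded about the right end and the momentum about the left end, because these
    are the remainders met in the momentum and the position error respectively. *)
Lemma hamiltonian_taylor1 : exists2 C, 0 <= C & forall a b,
  0 <= a -> a <= b -> b <= T ->
  `|q a - q b - (a - b) *: (invmx M *m p b)| <= C * (b - a) ^+ 2 /\
  `|p b - p a + (b - a) *: grad V (q a)| <= C * (b - a) ^+ 2.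
Proof.
have [m m0 norm_invmx] := mulmx_bound 1 (invmx M).
have [C C0 qpC] := hamiltonian_lipschitz; have [qc pc der] := ham.
exists (m * C + L * C) => [|a b a0 ab bT]; first by rewrite addr_ge0 ?mulr_ge0.
have in0T x : a < x < b -> 0 < x < T.
  by move=> /andP[ax xb]; rewrite (le_lt_trans a0)// (lt_le_trans xb).
have T0 : 0 <= T by rewrite (le_trans a0)// (le_trans ab).
have ba0 : 0 <= b - a by rewrite subr_ge0.
split; rewrite mulrDl.
  rewrite ler_wpDr ?mulr_ge0 ?exprn_ge0//.
  apply: mx_norm_le => [|i j]; first by rewrite !mulr_ge0 ?exprn_ge0.
  set w := invmx M *m p b.
  pose f x := q x i j - (x - a) * w i j.
  have -> : (q a - q b - (a - b) *: w) i j = - (f b - f a).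
    by rewrite /f !mxE; ring.
  rewrite normrN expr2 mulrA.
  apply: (@MVT_bound f (fun x => (invmx M *m p x) i j - w i j)) => //.
  - have qc' := @within_continuous_entry _ _ _ _ i j (continuous_sub a0 bT qc).
    apply: (within_continuousB qc').
    exact/continuous_subspaceT/continuous_shift_mul.
  - move=> x /in0T /der [dq _]; apply: is_deriveB.
      exact: is_derive_entry.
    exact: is_derive_shift_mul.
  - move=> x xab; have -> : (invmx M *m p x) i j - w i j =
        (invmx M *m (p x - p b)) i j by rewrite mulmxBr !mxE.
    rewrite (le_trans (mx_norm_entry _ _ _))// (le_trans (norm_invmx _))//.
    rewrite -mulrA ler_wpM2l// distrC.
    have /andP[ax xb] := xab.
    have [_ /le_trans] := qpC x b (le_trans a0 (ltW ax)) (ltW xb) bT; apply.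
    by rewrite ler_wpM2l// lerB// ltW.
rewrite ler_wpDl ?mulr_ge0 ?exprn_ge0//.
apply: mx_norm_le => [|i j]; first by rewrite !mulr_ge0 ?exprn_ge0.
set w := grad V (q a).
pose f x := p x i j + (x - a) * w i j.
have -> : (p b - p a + (b - a) *: w) i j = f b - f a by rewrite /f !mxE; ring.
rewrite expr2 mulrA.
apply: (@MVT_bound f (fun x => (- grad V (q x)) i j + w i j)) => //.
- have pc' := @within_continuous_entry _ _ _ _ i j (continuous_sub a0 bT pc).
  apply: (within_continuousD pc').
  exact/continuous_subspaceT/continuous_shift_mul.
- move=> x /in0T /der [_ dp]; apply: is_deriveD.
    exact: is_derive_entry.
  exact: is_derive_shift_mul.
- move=> x xab; have -> : (- grad V (q x)) i j + w i j =
      (w - grad V (q x)) i j by rewrite [LHS]addrC [RHS]mxE.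
  rewrite (le_trans (mx_norm_entry _ _ _))// distrC (le_trans (gradL _ _))//.
  rewrite -mulrA ler_wpM2l//.
  have /andP[ax xb] := xab.
  have [/le_trans + _] := qpC a x a0 (ltW ax) (le_trans (ltW xb) bT); apply.
  by rewrite ler_wpM2l// lerB// ltW.
Qed.

(** Pairs of a start time and a step length, the latter being the small parameter [snd]. *)
Definition substep : set (R * R) :=
  [set c | [/\ 0 <= c.1, 0 <= c.2 <= 1 & c.1 + c.2 <= T]].

(** As a function of the step length, the error vanishes at 0 and its derivative is [M^-1] applied
    to the first-order Taylor remainder of the momentum; a quadratic bound on the derivative gives a
    cubic one on the error. *)
Lemma hamiltonian_position_error : isO substep snd 3 (fun c =>
  q (c.1 + c.2) - (q c.1 + c.2 *: (invmx M *m (p c.1 - (c.2 / 2) *: grad V (q c.1))))).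
Proof.
have [m m0 norm_invmx] := mulmx_bound 1 (invmx M).
have [C C0 qpC] := hamiltonian_taylor1; have [qc pc der] := ham.
exists (m * C) => [|[t h] [/= t0 /andP[h0 h1] hT]]; first exact: mulr_ge0.
have in0T x : t < x < t + h -> 0 < x < T.
  by move=> /andP[ax xb]; rewrite (le_lt_trans t0)// (lt_le_trans xb).
apply: mx_norm_le => [|i j]; first by rewrite !mulr_ge0 ?exprn_ge0.
set v := invmx M *m p t; set w := invmx M *m grad V (q t).
pose f x := q x i j - (x - t) * v i j + (x - t) ^+ 2 * (w i j / 2).
have -> : (q (t + h) - (q t + h *: (invmx M *m (p t - (h / 2) *: grad V (q t))))) i j
    = f (t + h) - f t.
  by rewrite mulmxBr -scalemxAr -/v -/w /f !mxE; field.
have {2}-> : h = t + h - t by rewrite [t + h]addrC addrK.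
rewrite [_ ^+ 3]exprSr mulrA.
apply: (@MVT_bound f (fun x =>
    (invmx M *m p x) i j - v i j + 2 * (x - t) * (w i j / 2))).
- by rewrite lerDl.
- have qc' := @within_continuous_entry _ _ _ _ i j (continuous_sub t0 hT qc).
  have qvc := within_continuousB qc'
    (continuous_subspaceT (@continuous_shift_mul t (v i j))).
  exact: (within_continuousD qvc
    (continuous_subspaceT (@continuous_shift_sqr t (w i j / 2)))).
- move=> x /in0T /der [dq _]; apply: is_deriveD; last exact: is_derive_shift_sqr.
  by apply: is_deriveB; [exact: is_derive_entry | exact: is_derive_shift_mul].
- move=> x xab; have -> : (invmx M *m p x) i j - v i j + 2 * (x - t) * (w i j / 2) =
      (invmx M *m (p x - p t + (x - t) *: grad V (q t))) i j.
    by rewrite mulmxDr mulmxBr -scalemxAr -/v -/w !mxE; field.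
  rewrite (le_trans (mx_norm_entry _ _ _))// (le_trans (norm_invmx _))//.
  rewrite -mulrA ler_wpM2l//; have /andP[tx xh] := xab.
  have [_ /le_trans] := qpC t x t0 (ltW tx) (le_trans (ltW xh) hT); apply.
  rewrite ler_wpM2l// lerXn2r ?nnegrE ?subr_ge0 ?lerDl ?(ltW tx)//.
  by rewrite lerB// ltW.
Qed.

(* The error of the trapezoidal rule, differentiated in the step, is the
   second-order Taylor remainder of the force along the trajectory. *)
Lemma hamiltonian_momentum_error : isO substep snd 3 (fun c =>
  p (c.1 + c.2) - (p c.1 - (c.2 / 2) *: (grad V (q c.1) + grad V (q (c.1 + c.2))))).
Proof.
have [B B0 qpB] := hamiltonian_bounded.
have [Cl Cl0 qpCl] := hamiltonian_lipschitz.
have [Ct Ct0 qpCt] := hamiltonian_taylor1; have [qc pc der] := ham.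
apply: isO_mx => [c [_ //]|i j]; rewrite (ord1 j) => {j}.
set e : 'cV[R]_d := delta_mx i 0; pose g x := 'D_e V x.
have gs : smooth g by exact: smooth_derive.
have [C1 C10 gC1] := C1_derive_bound B (gs 1%N).
have [C2 C20 gC2] := C2_taylor B (gs 2%N).
exists (2^-1 * (C2 * Cl ^+ 2 + C1 * Ct)) => [|[t h] [/= t0 /andP[h0 h1] hT]].
  by rewrite mulr_ge0// addr_ge0// mulr_ge0 ?sqr_ge0.
have in0T x : t < x < t + h -> 0 < x < T.
  by move=> /andP[ax xb]; rewrite (le_lt_trans t0)// (lt_le_trans xb).
pose f x := p x i 0 + (x - t) * 2^-1 * (g (q t) + g (q x)).
have -> : (p (t + h) - (p t - (h / 2) *: (grad V (q t) + grad V (q (t + h))))) i 0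
    = f (t + h) - f t.
  by rewrite !mxE -/e -/(g (q t)) -/(g (q (t + h))) /f; field.
have {2}-> : h = t + h - t by rewrite [t + h]addrC addrK.
rewrite [_ ^+ 3]exprSr mulrA.
apply: (@MVT_bound f (fun x => - g (q x) +
    ((x - t) * 2^-1 * 'D_(invmx M *m p x) g (q x)
     + (g (q t) + g (q x)) * 2^-1))).
- by rewrite lerDl.
- have qc' := continuous_sub t0 hT qc.
  have pc' := @within_continuous_entry _ _ _ _ i 0 (continuous_sub t0 hT pc).
  apply: (within_continuousD pc'); apply: within_continuousM.
    exact/continuous_subspaceT/continuous_shift_mul.
  have gqc : {within `[t, t + h], continuous (g \o q)}.
    by move=> x; exact: (continuous_comp (qc' x) (smooth_continuous gs (x:=_))).
  apply: (within_continuousD _ gqc).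
  exact/continuous_subspaceT/cst_continuous.
- move=> x /in0T /der [dq dp].
  apply: is_deriveD.
    have := is_derive_entry i 0 dp.
    by move=> /is_derive_eq; apply; rewrite !mxE.
  have dg := is_derive_curve dq (smooth_differentiable (q x) gs).
  have := is_deriveM (is_derive_shift_mul t 2^-1 x)
    (is_deriveD (is_derive_cst (g (q t)) x (1 : R)) dg).
  by move=> /is_derive_eq; apply; rewrite add0r.
- move=> x xab; have /andP[tx xh] := xab; have /in0T /andP[x0 xT] := xab.
  have xin : 0 <= x <= T by rewrite !ltW.
  have tin : 0 <= t <= T by rewrite t0 (le_trans _ hT)// lerDl.
  have gd := smooth_differentiable (q x) gs.
  set v := invmx M *m p x.
  (* The first term is the spatial Taylor remainder of [g], the second its differential at the
     deviation of [q] from uniform motion; both are quadratic in [x - t]. *)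
  have -> : - g (q x) + ((x - t) * 2^-1 * 'D_v g (q x) + (g (q t) + g (q x)) * 2^-1)
     = 2^-1 * ((g (q t) - g (q x) - 'D_(q t - q x) g (q x))
        + 'D_(q t - q x - (t - x) *: v) g (q x)).
    by rewrite !deriveE// !linearB linearZ /= /GRing.scale /=; field.
  rewrite normrM ger0_norm// -mulrA ler_wpM2l// mulrDl.
  have xt2 : (x - t) ^+ 2 <= (t + h - t) ^+ 2.
    by rewrite lerXn2r ?nnegrE ?subr_ge0 ?lerDl ?(ltW tx)// lerB// ltW.
  rewrite (le_trans (ler_normD _ _))// lerD//.
    rewrite (le_trans (gC2 _ _ (qpB _ xin).1 (qpB _ tin).1))//.
    rewrite -mulrA ler_wpM2l// distrC (le_trans _ (ler_wpM2l (sqr_ge0 _) xt2))//.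
    rewrite -exprMn lerXn2r ?nnegrE ?mulr_ge0 ?subr_ge0 ?(ltW tx)//.
    by case: (qpCl t x t0 (ltW tx) (ltW xT)).
  rewrite (le_trans (gC1 _ _ (qpB _ xin).1))//.
  rewrite -mulrA ler_wpM2l//.
  have [/le_trans + _] := qpCt t x t0 (ltW tx) (ltW xT); apply.
  by rewrite ler_wpM2l.
Qed.

End Trajectory.
End ExactFlow.

(** * Convergence *)

Section Convergence.
Context {R : realType}.

(** Two perturbed Verlet steps are compared, later the numerical one and the exact flow. The growth
    rate [A] is fixed before the residual constant [C]; only [B] depends on [C]. *)
Lemma verlet_stability d (M : 'M[R]_d) (g : 'cV[R]_d -> 'cV[R]_d) (L : R) :
  0 <= L -> (forall x y, `|g y - g x| <= L * `|y - x|) ->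
  exists2 A, 0 < A & forall C, 0 <= C -> exists2 B, 0 <= B &
  forall dt, 0 < dt <= 1 -> forall q p q' p' Q P Q' P' : 'cV[R]_d,
  `|q' - (q + dt *: (invmx M *m (p - (dt / 2) *: g q)))| <= C * dt ^+ 3 ->
  `|p' - (p - (dt / 2) *: (g q + g q'))| <= C * dt ^+ 3 ->
  `|Q' - (Q + dt *: (invmx M *m (P - (dt / 2) *: g Q)))| <= C * dt ^+ 3 ->
  `|P' - (P - (dt / 2) *: (g Q + g Q'))| <= C * dt ^+ 3 ->
  `|q' - Q'| + `|p' - P'|
    <= (1 + A * dt) * (`|q - Q| + `|p - P|) + B * dt ^+ 3.
Proof.
move=> L0 gL; have [m m0 norm_invmx] := mulmx_bound 1 (invmx M).
(* The final 1 makes the rate positive, as the division by [A] in the Gronwall bound requires. *)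
exists (m * (1 + L) * (1 + L) + L + 1).
  by rewrite ltr_wpDl// addr_ge0// !mulr_ge0// addr_ge0.
move=> C C0; exists (4 * C + 2 * L * C).
  by rewrite addr_ge0// !mulr_ge0.
move=> dt /andP[dt0 dt1] q p q' p' Q P Q' P' qE pE QE PE.
set eq := `|q - Q|; set ep := `|p - P|; set eq' := `|q' - Q'|.
set ep' := `|p' - P'|.
have [eq0 ep0 eq'0] : [/\ 0 <= eq, 0 <= ep & 0 <= eq'].
  by split; exact: normr_ge0.
have dt3 : 0 <= C * dt ^+ 3 by rewrite mulr_ge0// exprn_ge0// ltW.
have eqle : eq' <= eq + dt * (m * (ep + L * eq)) + 2 * (C * dt ^+ 3).
  have -> : eq' = `|(q' - (q + dt *: (invmx M *m (p - (dt / 2) *: g q))))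
      - (Q' - (Q + dt *: (invmx M *m (P - (dt / 2) *: g Q))))
      + ((q - Q) + dt *: (invmx M *m ((p - P) - (dt / 2) *: (g q - g Q))))|.
    congr (`| _ |); rewrite !mulmxBr -!scalemxAr !mulmxBr.
    by apply/colP => i; rewrite !mxE; ring.
  rewrite (le_trans (ler_normD _ _))// addrC lerD//; last first.
    by rewrite (le_trans (ler_normB _ _))// mulr_natl mulr2n lerD.
  rewrite (le_trans (ler_normD _ _))// lerD2l normrZ gtr0_norm// ler_wpM2l ?(ltW dt0)//.
  rewrite (le_trans (norm_invmx _))// ler_wpM2l// (le_trans (ler_normB _ _))//.
  rewrite lerD2l normrZ gtr0_norm ?divr_gt0//.
  rewrite (le_trans _ (gL _ _))// ler_piMl// ler_pdivrMr// mul1r.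
  by rewrite (le_trans dt1)// ler1n.
have eple : ep' <= ep + dt / 2 * (L * eq + L * eq') + 2 * (C * dt ^+ 3).
  have -> : ep' = `|(p' - (p - (dt / 2) *: (g q + g q')))
      - (P' - (P - (dt / 2) *: (g Q + g Q')))
      + ((p - P) - (dt / 2) *: ((g q - g Q) + (g q' - g Q')))|.
    by congr (`| _ |); apply/colP => i; rewrite !mxE; ring.
  rewrite (le_trans (ler_normD _ _))// addrC lerD//; last first.
    by rewrite (le_trans (ler_normB _ _))// mulr_natl mulr2n lerD.
  rewrite (le_trans (ler_normB _ _))// lerD2l normrZ gtr0_norm ?divr_gt0//.
  rewrite ler_wpM2l ?divr_ge0 ?(ltW dt0)// (le_trans (ler_normD _ _))//.
  by rewrite lerD// gL.
have le1 : dt * (dt * (m * (ep + L * eq))) <= dt * (m * (ep + L * eq)).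
  by rewrite ler_piMl// !mulr_ge0 ?addr_ge0 ?mulr_ge0// ltW.
have le2 : dt * (C * dt ^+ 3) <= C * dt ^+ 3 by rewrite ler_piMl.
(* The force at the new position brings in [eq'], which [eqle] replaces; [dt <= 1] absorbs the
   surplus powers of [dt]. *)
have {}eple : ep' <= ep + dt * L * eq + L * (dt * (m * (ep + L * eq)))
     + L * (C * dt ^+ 3) + 2 * (C * dt ^+ 3).
  apply: (le_trans eple); rewrite lerD2r -!addrA lerD2l.
  have := ler_wpM2l (mulr_ge0 (ltW dt0) L0) eqle.
  have := ler_wpM2l L0 le1; have := ler_wpM2l L0 le2.
  have := mulr_ge0 (mulr_ge0 (ltW dt0) L0) eq'0.
  have : 0 <= L * (dt * (m * (ep + L * eq))).
    by rewrite !mulr_ge0 ?addr_ge0 ?mulr_ge0// ltW.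
  lra.
have : 0 <= dt * (m * (1 + L) * (eq + L * ep)).
  by rewrite !mulr_ge0 ?addr_ge0 ?mulr_ge0// ltW.
have : 0 <= dt * (L * ep) by rewrite !mulr_ge0// ltW.
have : 0 <= dt * (eq + ep) by rewrite mulr_ge0 ?addr_ge0// ltW.
have : 0 <= L * (C * dt ^+ 3) by rewrite mulr_ge0.
move: eqle eple; lra.
Qed.

(** The bound is the exact solution, starting from 0, of the recurrence with equality, so the
    induction step is an algebraic identity. *)
Lemma discrete_gronwall_step (A B dt e e' : R) k : 0 < A -> 0 < dt ->
  e' <= (1 + A * dt) * e + B * dt ^+ 3 ->
  e <= B / A * dt ^+ 2 * ((1 + A * dt) ^+ k - 1) ->
  e' <= B / A * dt ^+ 2 * ((1 + A * dt) ^+ k.+1 - 1).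
Proof.
move=> A0 dt0 e'le ele; rewrite (le_trans e'le)//.
have Adt0 : 0 <= 1 + A * dt by rewrite addr_ge0// mulr_ge0 ?ltW.
rewrite (le_trans (lerD (ler_wpM2l Adt0 ele) (lexx _)))//.
rewrite le_eqVlt; apply/orP; left; apply/eqP; rewrite [_ ^+ k.+1]exprS; field.
by rewrite gt_eqF.
Qed.

Lemma growth_le (A dt T : R) k : 0 < A -> 0 < dt -> k%:R * dt <= T ->
  (1 + A * dt) ^+ k - 1 <= expR (A * T).
Proof.
move=> A0 dt0 kT; have Adt0 : 0 <= A * dt by rewrite mulr_ge0 ?ltW.
rewrite lerBlDr ler_wpDr// (@le_trans _ _ (expR (A * dt) ^+ k))//.
  by rewrite lerXn2r ?nnegrE ?expR_ge0 ?addr_ge0// expR_ge1Dx.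
by rewrite -expRM_natl ler_expR mulrCA ler_wpM2l ?(ltW A0).
Qed.

Lemma lipschitz_bound (E F : normedModType R) (f : E -> F) : lipschitz f ->
  exists2 L, 0 <= L & forall x y, `|f y - f x| <= L * `|y - x|.
Proof.
move=> [L0 [_ fL]]; exists (Num.max 0 L0 + 1) => [|x y].
  by rewrite addr_ge0// le_max lexx.
have /fL/(_ (y, x)) : L0 < Num.max 0 L0 + 1.
  by rewrite ltr_pwDr// le_max lexx orbT.
by apply.
Qed.

(** The only quantitative property of a scheme that the convergence proof uses, common to (A) and
    (B). *)
Definition verlet_accurate d n (M : 'M[R]_d) (Mz : 'M[R]_n) (V : 'cV[R]_d -> R)
    (xi : 'cV[R]_d -> 'cV[R]_n) (nubar r0 : R) (S : scheme R d n) : Prop :=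
  forall r, exists2 dt1, 0 < dt1 & exists2 C, 0 <= C &
  forall dt, 0 < dt <= dt1 ->
  forall s s' l, `|pos s| <= r -> `|mom s| <= r ->
  on_constraints M Mz xi (nubar * dt) s ->
  local_step r0 S (nubar * dt) dt s l s' ->
  [/\ on_constraints M Mz xi (nubar * dt) s',
      `|pos s' - (pos s + dt *: (invmx M *m (mom s - (dt / 2) *: grad V (pos s))))|
         <= C * dt ^+ 3
    & `|mom s' - (mom s - (dt / 2) *: (grad V (pos s) + grad V (pos s')))|
         <= C * dt ^+ 3].

(** The scheme and the exact flow are both Verlet steps with third-order residuals; over a number of
    steps of order [1 / dt] these accumulate to second order. *)
Lemma verlet_accurate_converges d n (M : 'M[R]_d) (Mz : 'M[R]_n)
    (V : 'cV[R]_d -> R) (xi : 'cV[R]_d -> 'cV[R]_n) (nubar r0 : R)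
    (S : scheme R d n) : Mz \in unitmx -> 0 < nubar -> smooth V ->
  lipschitz (grad V) -> verlet_accurate M Mz V xi nubar r0 S ->
  locally_well_defined M Mz xi nubar r0 S ->
  converges_at_order2 M Mz V xi nubar r0 S.
Proof.
move=> Mzu nubar0 Vs /lipschitz_bound[L L0 gradL] Sacc wd T q p T0 ham.
have [Bd Bd0 qpB] := hamiltonian_bounded ham.
have [Cq Cq0 qE] := hamiltonian_position_error ham L0 gradL.
have [Cp Cp0 pE] := hamiltonian_momentum_error Vs ham L0 gradL.
pose r := Bd + 1.
have [dt1 dt10 [Cs Cs0 sE]] := Sacc r.
pose K := [set x : 'cV[R]_d | `|x| <= r] `*` [set x : 'cV[R]_d | `|x| <= r].
have cball := @compact_cball R d r.
have [dt2 [dt20 wdK]] := wd K (compact_setX cball cball).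
have [A A0 stab] := verlet_stability M L0 gradL.
have [B B0 {}stab] := stab (Cs + Cq + Cp) (addr_ge0 (addr_ge0 Cs0 Cq0) Cp0).
pose C := B / A * expR (A * T).
have C0 : 0 <= C by rewrite mulr_ge0 ?expR_ge0// divr_ge0// ltW.
(* Below this threshold [C * dt ^+ 2 <= 1], so the numerical states stay in the tube of radius 1
   that defines [r]. *)
pose dt3 := Num.min 1 (C + 1)^-1.
exists C; exists (Num.min dt1 (Num.min dt2 dt3)).
split; first by rewrite !lt_min dt10 dt20 ltr01 invr_gt0 ltr_wpDl.
move=> dt /andP[dt0]; rewrite !le_min => /and4P[dtle1 dtle2 dtle dtle3] N NT traj.
have Cdt : C * dt ^+ 2 <= 1.
  have : dt * (C + 1) <= 1 by rewrite -ler_pdivlMr ?mul1r// ltr_wpDl.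
  have : dt * (C * dt) <= 1 * (C * dt) by rewrite ler_wpM2r// mulr_ge0// ltW.
  by rewrite expr2; move: dt0; lra.
pose e (s : nat -> state R d n) k :=
  `|pos (s k) - q (k%:R * dt)| + `|mom (s k) - p (k%:R * dt)|.
have tk k : (k <= N)%N -> 0 <= k%:R * dt <= T.
  move=> kN; rewrite mulr_ge0 ?(ltW dt0)//= (le_trans _ NT)//.
  by rewrite ler_wpM2r ?ler_nat ?(ltW dt0).
have near_exact s k : (k <= N)%N -> e s k <= C * dt ^+ 2 ->
    `|pos (s k)| <= r /\ `|mom (s k)| <= r.
  move=> kN ek; have [qb pb] := qpB _ (tk _ kN).
  have e1 := le_trans ek Cdt.
  rewrite -[pos (s k)](subrK (q (k%:R * dt))) -[mom (s k)](subrK (p (k%:R * dt))).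
  split; rewrite (le_trans (ler_normD _ _))// addrC lerD//.
    by rewrite (le_trans _ e1)// lerDl.
  by rewrite (le_trans _ e1)// lerDr.
pose tr s k := numerical_trajectory M Mz xi r0 S (nubar * dt) dt (q 0) (p 0) k s.
have geoC k : (k <= N)%N ->
    B / A * dt ^+ 2 * ((1 + A * dt) ^+ k - 1) <= C * dt ^+ 2.
  move=> kN; rewrite /C [leRHS]mulrAC ler_wpM2l//.
    by rewrite mulr_ge0 ?divr_ge0 ?sqr_ge0// ltW.
  by apply: growth_le => //; case/andP: (tk _ kN).
(* Bootstrap: the bound at index [k] keeps the state in the ball of radius [r], where the step
   estimate yields the bound at the next index. *)
have error s k : tr s k -> (k <= N)%N ->
    on_constraints M Mz xi (nubar * dt) (s k) /\
    e s k <= B / A * dt ^+ 2 * ((1 + A * dt) ^+ k - 1).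
  elim: k => [|k IH] [s0 s0' con step] kN.
    by split => //; rewrite /e s0 s0' mul0r !subrr !normr0 addr0 mulr0.
  have [|conk ek] := IH _ (ltnW kN).
    by split => // j jk; exact/step/(ltn_trans jk).
  have [qr pr] := near_exact s k (ltnW kN) (le_trans ek (geoC _ (ltnW kN))).
  have [l stepk] := step k (ltnSn k).
  have [|con' posE momE] := sE dt _ (s k) (s k.+1) l qr pr conk stepk.
    by rewrite dt0.
  split => //; apply: discrete_gronwall_step ek => //.
  have [tk0 _] := andP (tk _ (ltnW kN)); have [_ tk1] := andP (tk _ kN).
  have k1 : k.+1%:R * dt = k%:R * dt + dt by rewrite -natr1 mulrDl mul1r.
  have sub : @substep R T (k%:R * dt, dt).
    by split; rewrite /= -?k1// (ltW dt0).
  have dt3_0 : 0 <= dt ^+ 3 by rewrite exprn_ge0// ltW.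
  have le_s : Cs <= Cs + Cq + Cp by rewrite -addrA lerDl addr_ge0.
  have le_q : Cq <= Cs + Cq + Cp by rewrite addrAC lerDr addr_ge0.
  have le_p : Cp <= Cs + Cq + Cp by rewrite lerDr addr_ge0.
  rewrite /e k1; apply: stab; first by rewrite dt0.
  - by rewrite (le_trans posE)// ler_wpM2r.
  - by rewrite (le_trans momE)// ler_wpM2r.
  - by rewrite (le_trans (qE _ sub))// ler_wpM2r.
  - by rewrite (le_trans (pE _ sub))// ler_wpM2r.
have errorC s k : tr s k -> (k <= N)%N -> e s k <= C * dt ^+ 2.
  by move=> trk kN; have [_ /le_trans] := error s k trk kN; apply; exact: geoC.
split; last first.
  move=> s trs k kN.
  have trk : tr s k.
    by case: trs => s0 s0' con step; split => // j jk; exact/step/(leq_trans jk).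
  have ek := errorC s k trk kN.
  by split; rewrite (le_trans _ ek)// (lerDl, lerDr).
suff : forall k, (k <= N)%N -> exists s, tr s k by move=> /(_ N (leqnn N)).
elim=> [|k IH] kN.
  pose nu := nubar * dt.
  (* The constraints determine [z] and [p^z] from the initial data; for zero steps a constant
     sequence suffices. *)
  exists (fun=> State (q 0) (p 0) (nu *: xi (q 0))
    (nu *: (Mz *m ((gradm xi (q 0))^T *m invmx M *m p 0)))); split => //.
  have nu0 : nu != 0 by rewrite mulf_neq0 ?gt_eqF.
  by split; rewrite /= ?scalemxAr -?scalemxAr scalerA mulVf// scale1r// mulKmx.
have [s trs] := IH (ltnW kN).
have [conk _] := error s k trs (ltnW kN).
have [qr pr] := near_exact s k (ltnW kN) (errorC _ _ trs (ltnW kN)).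
have [|l [[s' step] _]] := wdK dt _ (s k) (conj qr pr) conk; first by rewrite dt0.
exists (fun j => if (j <= k)%N then s j else s').
case: trs => s0 s0' con steps; split => // j.
rewrite ltnS leq_eqVlt => /predU1P[->|jk].
  by rewrite eqxx ltnn; exists l.
by rewrite jk orbT; exact: steps.
Qed.

End Convergence.

(** * Scheme (B) *)

Section SchemeB.
Context {R : realType} {d n : nat}.

Lemma is_diff_slice1 (U : 'cV[R]_d * 'cV[R]_n -> R) x y :
  differentiable U (x, y) ->
  is_diff x (fun x' => U (x', y)) (fun e => 'd U (x, y) (e, 0)).
Proof.
move=> Ud; have xyd : is_diff x (fun x' : 'cV[R]_d => (x', y)) (fun e => (e, 0)).
  exact: (is_diff_pair (is_diff_id x) (is_diff_cst y x)).
exact: (is_diff_comp xyd (differentiableP Ud)).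
Qed.

Lemma is_diff_slice2 (U : 'cV[R]_d * 'cV[R]_n -> R) x y :
  differentiable U (x, y) ->
  is_diff y (fun y' => U (x, y')) (fun e => 'd U (x, y) (0, e)).
Proof.
move=> Ud; have xyd : is_diff y (fun y' : 'cV[R]_n => (x, y')) (fun e => (0, e)).
  exact: (is_diff_pair (is_diff_cst x y) (is_diff_id y)).
exact: (is_diff_comp xyd (differentiableP Ud)).
Qed.

Lemma is_diff_derive (E F : normedModType R) (f df : E -> F) x e :
  is_diff x f df -> 'D_e f x = df e.
Proof. by move=> fd; rewrite deriveE ?diff_val. Qed.

Context {U : 'cV[R]_d * 'cV[R]_n -> R} {xi : 'cV[R]_d -> 'cV[R]_n}.
Hypotheses (Us : smooth U) (xis : smooth xi).

(** Chain rule along the graph of [xi]. The second term lies in the range of [gradm xi], where the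
    multipliers act. *)
Lemma grad_graph x : grad (fun x => U (x, xi x)) x =
  grad1 U x (xi x) + gradm xi x *m grad2 U x (xi x).
Proof.
have Ud y := smooth_differentiable y Us.
have xid := smooth_differentiable x xis.
have xyd : is_diff x (fun x' => (x', xi x')) (fun e => (e, 'd xi x e)).
  exact: (is_diff_pair (is_diff_id x) (differentiableP xid)).
apply/colP => j; rewrite !mxE.
rewrite (is_diff_derive _ (is_diff_comp xyd (differentiableP (Ud _)))) /=.
rewrite (is_diff_derive _ (is_diff_slice1 (Ud _))).
set e := delta_mx j 0; set w := 'd xi x e.
transitivity ('d U (x, xi x) ((e, 0) + (0, w))).
  by congr ('d U _ _); congr pair; rewrite ?addr0 ?add0r.
rewrite linearD; congr (_ + _).
have slice2 := is_diff_slice2 (Ud (x, xi x)).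
rewrite -(is_diff_derive _ slice2) derive_col//.
apply: eq_bigr => i _; rewrite !mxE; congr (_ * _).
by rewrite /w -deriveE// derive_mx ?mxE//; exact: diff_derivable.
Qed.

Lemma grad2_graph_bounded r :
  exists C, forall x, `|x| <= r -> `|grad2 U x (xi x)| <= C.
Proof.
have gc i : continuous (fun x => 'D_(0, delta_mx i 0) U (x, xi x)).
  have Uc := smooth_continuous (smooth_derive (0, delta_mx i 0) Us).
  have graphc : continuous (fun x => (x, xi x)).
    move=> x; have xid := smooth_differentiable x xis.
    exact: (differentiable_continuous (differentiable_pair _ xid)).
  move=> x; exact: (continuous_comp (graphc x) (Uc _)).
have [C C0 gC] := @cball_family_bounded R d 'I_n R _ r gc.
exists C => x xr; apply: mx_norm_le => // i j.
have Ud := smooth_differentiable (x, xi x) Us.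
by rewrite mxE (is_diff_derive _ (is_diff_slice2 Ud)) -deriveE// gC.
Qed.

(** By [grad_graph] the forces of the two schemes differ by [gradm xi] times [grad2 U], which the
    shifted multiplier compensates; the same shift accounts for the extra force on [p^z]. *)
Lemma schemeB_schemeA fixman (M : 'M[R]_d) (Mz : 'M[R]_n) beta V nu dt
    (s s' : state R d n) l1 l2 : (forall x, V x = U (x, xi x)) ->
  schemeB fixman M Mz beta U xi nu dt s l1 l2 s' ->
  schemeA fixman M Mz beta V xi nu dt s
    (l1 - (dt / 2) *: grad2 U (pos s) (xi (pos s)))
    (l2 - (dt / 2) *: grad2 U (pos s') (xi (pos s'))) s'.
Proof.
move=> VE; have -> : V = (fun x => U (x, xi x)) by exact/funext.
move=> [ph [pzh [[phE pzhE] [posE [p'E pz'E con]]]]].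
exists ph, pzh; split; [split | split=> //; split=> //].
- rewrite phE grad_graph mulmxBr -scalemxAr.
  move: (grad1 _ _ _) (_ *m grad2 _ _ _) (grad_fix _ _ _ _ _ _ _) (_ *m l1).
  by move=> a b c e; apply/colP => i; rewrite !mxE; ring.
- rewrite pzhE invfM mulrA scalerBr scalerA.
  move: (grad2 _ _ _) => a.
  by apply/colP => i; rewrite !mxE; ring.
- rewrite p'E grad_graph mulmxBr -scalemxAr.
  move: (grad1 _ _ _) (_ *m grad2 _ _ _) (grad_fix _ _ _ _ _ _ _) (_ *m l2).
  by move=> a b c e; apply/colP => i; rewrite !mxE; ring.
- rewrite pz'E invfM mulrA scalerBr scalerA.
  move: (grad2 _ _ _) => a.
  by apply/colP => i; rewrite !mxE; ring.
Qed.

End SchemeB.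

Unset Implicit Arguments.

Theorem proposition4p4 (R : realType) (d n : nat) (M : 'M[R]_d) (Mz : 'M[R]_n)
    (beta : R) (V : 'cV[R]_d -> R) (xi : 'cV[R]_d -> 'cV[R]_n)
    (nubar r : R) (fixman : bool)
    (hM : symmetric_posdef M) (hMz : symmetric_posdef Mz) (hbeta : 0 < beta)
    (hV : smooth V) (hxi : smooth xi) (hLip : lipschitz (grad V))
    (hnubar : 0 < nubar) (hr : 0 < r) :
  (locally_well_defined M Mz xi nubar r (schemeA fixman M Mz beta V xi) ->
   converges_at_order2 M Mz V xi nubar r (schemeA fixman M Mz beta V xi)) /\
  (forall U : 'cV[R]_d * 'cV[R]_n -> R,
   smooth U -> (forall x : 'cV[R]_d, V x = U (x, xi x)) ->
   locally_well_defined M Mz xi nubar r (schemeB fixman M Mz beta U xi) ->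
   converges_at_order2 M Mz V xi nubar r (schemeB fixman M Mz beta U xi)).
Proof.
have Mzu := posdef_unit hMz.2.
split=> [|U Us VU].
  apply: verlet_accurate_converges => // rho.
  have [|dt1 dt10 [C C0 est]] := stepA_estimate (fixman := fixman) (beta := beta)
      hM hMz hV hxi hnubar rho (rb := fun=> r).
    by move=> r1; exists r.
  exists dt1 => //; exists C => // dt dtP s s' [l1 l2] qr pr con [l1r l2r step].
  exact: est step.
apply: verlet_accurate_converges => // rho.
pose g x := grad2 U x (xi x).
have [|dt1 dt10 [C C0 est]] := stepA_estimate (fixman := fixman) (beta := beta)
    hM hMz hV hxi hnubar rho (rb := fun x => r + `|g x|).
  move=> r1; have [C gC] := grad2_graph_bounded Us hxi r1.
  by exists (r + C) => x xr; rewrite lerD2l gC.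
(* With [dt <= 1] the factor [dt / 2] is at most 1, so the shift of the multipliers is bounded by
   the norm of [g x]. *)
exists (Num.min 1 dt1); first by rewrite lt_min ltr01.
exists C => // dt /andP[dt0]; rewrite le_min => /andP[dt_le1 dt_le].
move=> s s' [l1 l2] qr pr con [/= l1r l2r step].
have shift l x : `|l| <= r -> `|l - (dt / 2) *: g x| <= r + `|g x|.
  move=> lr; rewrite (le_trans (ler_normB _ _))// lerD// normrZ ler_piMl//.
  by rewrite gtr0_norm ?divr_gt0// ler_pdivrMr// mul1r (le_trans dt_le1)// ler1n.
apply: est (schemeB_schemeA Us hxi VU step) => //; rewrite ?dt0//; exact: shift.
Qed.
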